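(* For every integer $n\ge 2$, $\theta(K_n\times K_2)=\lceil n/4\rceil$.
   Context: The thickness $\theta(G)$ of a graph $G$ is the minimum number of planar subgraphs whose union is $G$. The Kronecker product $G\times H$ of graphs $G$ and $H$ is the graph with vertex set $V(G)\times V(H)$ in which $(g,h)$ and $(g',h')$ are adjacent if and only if $gg'\in E(G)$ and $hh'\in E(H)$. $K_n$ denotes the complete graph on $n$ vertices. *)

(* Defs.v *)
From Stdlib Require Import Reals Arith.
Open Scope R_scope.

(* A simple graph: a vertex predicate on a carrier type and an adjacency
   relation (for the graphs used here it is symmetric and irreflexive). *)
Record graph := Graph {
  gV : Type;
  gvert : gV -> Prop;
  gadj : gV -> gV -> Prop
}.

Definition K (n : nat) : graph :=
  Graph nat (fun i => (i < n)%nat)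
        (fun i j => (i < n)%nat /\ (j < n)%nat /\ i <> j).

Definition kron (G H : graph) : graph :=
  Graph (gV G * gV H)
        (fun p => gvert G (fst p) /\ gvert H (snd p))
        (fun p q => gvert G (fst p) /\ gvert H (snd p) /\
                    gvert G (fst q) /\ gvert H (snd q) /\
                    gadj G (fst p) (fst q) /\ gadj H (snd p) (snd q)).

Definition unit_I (t : R) : Prop := 0 <= t <= 1.
Definition open_I (t : R) : Prop := 0 < t < 1.

Definition cont01 (f : R -> R) : Prop :=
  forall t, unit_I t -> limit1_in f unit_I (f t) t.

Definition arc (c : R -> R * R) (a b : R * R) : Prop :=
  cont01 (fun t => fst (c t)) /\ cont01 (fun t => snd (c t)) /\
  c 0 = a /\ c 1 = b /\
  (forall s t, unit_I s -> unit_I t -> c s = c t -> s = t).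

(* The graph with vertex set P and edge set E (E an edge relation whose
   pairs x y are read as unordered edges {x,y}) is planar: it has a drawing
   in R^2 with distinct vertex points, each edge drawn as an arc between its
   endpoints, arcs avoiding vertex points in their interiors, and distinct
   edges having disjoint arc interiors. *)
Definition planar {V : Type} (P : V -> Prop) (E : V -> V -> Prop) : Prop :=
  exists (pos : V -> R * R) (path : V -> V -> R -> R * R),
    (forall x y, P x -> P y -> pos x = pos y -> x = y) /\
    (forall x y, P x -> P y -> E x y -> arc (path x y) (pos x) (pos y)) /\
    (forall x y z t, P x -> P y -> P z -> E x y -> open_I t ->
        path x y t <> pos z) /\
    (forall x y x' y' s t, P x -> P y -> P x' -> P y' -> E x y -> E x' y' ->
        ~ ((x = x' /\ y = y') \/ (x = y' /\ y = x')) ->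
        open_I s -> open_I t -> path x y s <> path x' y' t).

Definition union_of_planar (G : graph) (k : nat) : Prop :=
  exists (SV : nat -> gV G -> Prop) (SE : nat -> gV G -> gV G -> Prop),
    (forall i x, (i < k)%nat -> SV i x -> gvert G x) /\
    (forall i x y, (i < k)%nat -> SE i x y -> SV i x /\ SV i y /\ gadj G x y) /\
    (forall x, gvert G x -> exists i, (i < k)%nat /\ SV i x) /\
    (forall x y, gvert G x -> gvert G y -> gadj G x y ->
        exists i, (i < k)%nat /\ SE i x y) /\
    (forall i, (i < k)%nat -> planar (SV i) (SE i)).

Definition is_thickness (G : graph) (t : nat) : Prop :=
  union_of_planar G t /\ (forall k, union_of_planar G k -> (t <= k)%nat).

(* Main.v *)
Require Import Defs.
From Stdlib Require Import Reals Arith.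
From Stdlib Require Import Lra Lia ZArith List Classical Relation_Operators Operators_Properties.
From mathcomp Require all_boot all_order all_algebra boolp zify.

(* Lower bound. K_n x K_2 is the bipartite graph on n black and n white vertices
   whose n(n-1) edges join a to b for a <> b, so it suffices that a planar
   bipartite graph on n + n vertices has at most 4n - 2 edges. After squashing
   the plane into the unit square and rounding a drawing to a fine grid, the
   graph becomes a minor of a finite square grid. Over F_2 every cycle of the
   grid is a sum of unit squares; merging squares across the grid segments that
   the minor does not use gives faces that span the cycle space of the minor and
   cover each edge at most twice. A nonzero face has at least four edges and the
   cycle space has dimension at least m - 2n + 1, whence 4(m - 2n + 1) <= 2m.

   Upper bound. Cut the vertices into blocks of four. The layer of a block draws
   the cube K_4 x K_2 on it as two concentric squares with spokes. Each of the
   four faces between the squares receives half of the black, or half of the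
   white, vertices of every other block, placed on one diagonal and joined to
   the two ends of the other diagonal. *)

(** * Separation and grid approximation of curves *)

Definition grid_adj (p q : nat * nat) : Prop :=
  (fst p = fst q /\ (S (snd p) = snd q \/ S (snd q) = snd p)) \/
  (snd p = snd q /\ (S (fst p) = fst q \/ S (fst q) = fst p)).

Definition grid_joined (B : nat * nat -> Prop) : nat * nat -> nat * nat -> Prop :=
  clos_refl_trans _ (fun p q => B p /\ B q /\ grid_adj p q).

(* [B false a] and [B true b] are the branch sets of the black vertex a and of
   the white vertex b. *)
Definition grid_minor (n : nat) (E : nat -> nat -> Prop) : Prop :=
  exists (N : nat) (B : bool -> nat -> nat * nat -> Prop),
    (forall s i p, B s i p -> (0 < fst p < N)%nat /\ (0 < snd p < N)%nat) /\
    (forall s i s' i' p, B s i p -> B s' i' p -> s = s' /\ i = i') /\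
    (forall s i p q, B s i p -> B s i q -> grid_joined (B s i) p q) /\
    (forall a b, (a < n)%nat -> (b < n)%nat -> E a b ->
       exists p q, B false a p /\ B true b q /\ grid_adj p q).

(** Compactness of a segment without covers: at the supremum of the [s] with [P u s], the local
    hypothesis carries [P u] further unless the supremum is [v]. *)
Lemma interval_ind (P : R -> R -> Prop) (u v : R) : u <= v ->
  (forall x y z, u <= x <= y -> y <= z <= v -> P x y -> P y z -> P x z) ->
  (forall s, u <= s <= v -> exists e, 0 < e /\
     forall x y, u <= x <= y -> y <= v -> s - e < x -> y < s + e -> P x y) ->
  P u v.
Proof.
intros uv trans loc.
set (A := fun s => u <= s <= v /\ P u s).
destruct (completeness A) as [m [mub mlub]].
{ exists v; intros s [? _]; lra. }
{ exists u; split; [lra|].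
  destruct (loc u) as [e [e0 H]]; [lra|]; apply H; lra. }
assert (Au : A u).
{ split; [lra|]. destruct (loc u) as [e [e0 H]]; [lra|]; apply H; lra. }
assert (um : u <= m) by (apply mub; exact Au).
assert (mv : m <= v) by (apply mlub; intros s [? _]; lra).
destruct (loc m) as [e [e0 H]]; [lra|].
assert (exists s, A s /\ m - e < s) as [s [As ms]].
{ apply NNPP; intros no. assert (m <= m - e); [|lra].
  apply mlub; intros s As; apply Rnot_lt_le; intros lt; apply no; exists s; auto. }
assert (s <= m) by (apply mub; exact As).
destruct As as [sb Ps].
set (w := Rmin v (m + e / 2)).
assert (w <= v) by apply Rmin_l.
assert (w <= m + e / 2) by apply Rmin_r.
assert (m <= w) by (apply Rmin_glb; lra).
assert (Aw : A w).
{ split; [lra|]. apply (trans u s w); try lra; auto. apply H; lra. }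
assert (w <= m) by (apply mub; exact Aw).
assert (wv : w = v).
{ destruct (Rle_or_lt v (m + e / 2)) as [l|l]; unfold w in *; [apply Rmin_left; lra|].
  rewrite Rmin_right in *; lra. }
rewrite <- wv; apply Aw.
Qed.

Definition far (d : R) (p q : R * R) : Prop :=
  d <= Rabs (fst p - fst q) \/ d <= Rabs (snd p - snd q).

Definition cont_pair (c : R -> R * R) : Prop :=
  cont01 (fun t => fst (c t)) /\ cont01 (fun t => snd (c t)).

Lemma cont_pair_loc c s e : cont_pair c -> unit_I s -> 0 < e ->
  exists d, 0 < d /\ forall t, unit_I t -> s - d < t < s + d ->
    Rabs (fst (c t) - fst (c s)) < e /\ Rabs (snd (c t) - snd (c s)) < e.
Proof.
intros [c1 c2] us e0.
destruct (c1 s us e e0) as [d1 [d10 H1]], (c2 s us e e0) as [d2 [d20 H2]].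
exists (Rmin d1 d2); split; [apply Rmin_glb_lt; lra|].
intros t ut Ht; simpl in H1, H2; unfold Rdist in H1, H2.
pose proof (Rmin_l d1 d2); pose proof (Rmin_r d1 d2).
split; [apply H1|apply H2]; split; auto; apply Rabs_def1; lra.
Qed.

Lemma far_weaken d d' p q : d' <= d -> far d p q -> far d' p q.
Proof. unfold far; lra. Qed.

Lemma far_move d p q p' q' : far (3 * d) p q ->
  Rabs (fst p' - fst p) < d -> Rabs (snd p' - snd p) < d ->
  Rabs (fst q' - fst q) < d -> Rabs (snd q' - snd q) < d -> far d p' q'.
Proof.
assert (H : forall x y x' y', 3 * d <= Rabs (x - y) -> Rabs (x' - x) < d ->
  Rabs (y' - y) < d -> d <= Rabs (x' - y')).
{ intros x y x' y'; unfold Rabs; repeat destruct Rcase_abs; lra. }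
intros [h|h] ? ? ? ?; [left|right]; eapply H; eauto.
Qed.

(** Disjoint compact curves have positive distance. [interval_ind] runs over the parameter of [c]
    and, near a fixed [s0], over that of [c']. *)
Lemma separated c c' u v u' v' : cont_pair c -> cont_pair c' ->
  0 <= u <= v -> v <= 1 -> 0 <= u' <= v' -> v' <= 1 ->
  (forall s t, u <= s <= v -> u' <= t <= v' -> c s <> c' t) ->
  exists d, 0 < d /\ forall s t, u <= s <= v -> u' <= t <= v' -> far d (c s) (c' t).
Proof.
intros cc cc' uv v1 uv' v1' dis.
apply (interval_ind (fun x y => exists d, 0 < d /\
  forall s t, x <= s <= y -> u' <= t <= v' -> far d (c s) (c' t))); [lra| |].
{ intros x y z xy yz [d1 [d10 H1]] [d2 [d20 H2]].
  exists (Rmin d1 d2); split; [apply Rmin_glb_lt; lra|].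
  intros s t Hs Ht; destruct (Rle_or_lt s y).
  - apply far_weaken with d1; [apply Rmin_l|apply H1; lra].
  - apply far_weaken with d2; [apply Rmin_r|apply H2; lra]. }
intros s0 Hs0.
(* One [d] is both the radius around [s0] and the distance, so a minimum adjusts both when intervals
   of [t] are concatenated. *)
assert (exists d, 0 < d /\ forall s t, u <= s <= v -> s0 - d < s < s0 + d ->
  u' <= t <= v' -> far d (c s) (c' t)) as [d [d0 H]].
{ apply (interval_ind (fun x y => exists d, 0 < d /\ forall s t, u <= s <= v ->
    s0 - d < s < s0 + d -> x <= t <= y -> far d (c s) (c' t))); [lra| |].
  { intros x y z xy yz [d1 [d10 H1]] [d2 [d20 H2]].
    exists (Rmin d1 d2); split; [apply Rmin_glb_lt; lra|].
    pose proof (Rmin_l d1 d2); pose proof (Rmin_r d1 d2).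
    intros s t Hs Hs' Ht; destruct (Rle_or_lt t y).
    - apply far_weaken with d1; [lra|apply H1; lra].
    - apply far_weaken with d2; [lra|apply H2; lra]. }
  intros t0 Ht0.
  assert (exists d, 0 < d /\ far (3 * d) (c s0) (c' t0)) as [d [d0 Hd]].
  { set (x := Rabs (fst (c s0) - fst (c' t0))); set (y := Rabs (snd (c s0) - snd (c' t0))).
    assert (0 < x \/ 0 < y) as [h|h].
    { apply NNPP; intros no. apply (dis s0 t0); try lra.
      pose proof (Rabs_pos (fst (c s0) - fst (c' t0))).
      pose proof (Rabs_pos (snd (c s0) - snd (c' t0))).
      destruct (c s0) as [a b], (c' t0) as [a' b']; simpl in *.
      f_equal; apply Rminus_diag_uniq; apply NNPP; intros nz; apply no;
        [left|right]; apply Rabs_pos_lt; auto. }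
    - exists (x / 3); split; [lra|]; left; unfold x; lra.
    - exists (y / 3); split; [lra|]; right; unfold y; lra. }
  destruct (cont_pair_loc c s0 d) as [e1 [e10 H1]]; auto; [split; lra|].
  destruct (cont_pair_loc c' t0 d) as [e2 [e20 H2]]; auto; [split; lra|].
  exists e2; split; auto; intros x y xy yv xe ye.
  exists (Rmin d e1); split; [apply Rmin_glb_lt; lra|].
  pose proof (Rmin_l d e1); pose proof (Rmin_r d e1).
  intros s t Hs Hs' Ht; apply far_weaken with d; [lra|].
  destruct (H1 s) as [? ?]; [split; lra|lra|].
  destruct (H2 t) as [? ?]; [split; lra|lra|].
  apply far_move with (c s0) (c' t0); auto. }
exists d; split; auto; intros x y xy yv xd yd; exists d; split; auto.
intros s t Hs Ht; apply H; lra.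
Qed.

(** The successor numbers cells from 1, which keeps the cells of the open unit square off the border
    of the grid. *)
Definition cell (N : nat) (x : R) : nat := S (Z.to_nat (Int_part (INR N * x))).

Lemma cell_spec N x : 0 <= x -> INR (cell N x) - 1 <= INR N * x < INR (cell N x).
Proof.
intros x0; unfold cell; rewrite S_INR.
assert (0 <= INR N * x) by (apply Rmult_le_pos; [apply pos_INR|lra]).
pose proof (base_Int_part (INR N * x)) as [H1 H2].
assert (0 <= Int_part (INR N * x))%Z.
{ apply Z.lt_succ_r, lt_IZR; rewrite succ_IZR; lra. }
rewrite INR_IZR_INZ, Z2Nat.id by auto; lra.
Qed.

(** A cell lies within 1 of its scaled point; the tolerance 2 also admits the corner that links
    diagonally adjacent cells in [trace_joined]. *)
Definition near (N : nat) (g : nat * nat) (p : R * R) : Prop :=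
  Rabs (INR (fst g) - INR N * fst p) <= 2 /\ Rabs (INR (snd g) - INR N * snd p) <= 2.

Definition cells (N : nat) (p : R * R) : nat * nat := (cell N (fst p), cell N (snd p)).

Definition trace (N : nat) (c : R -> R * R) (u v : R) (g : nat * nat) : Prop :=
  ((0 < fst g < S N)%nat /\ (0 < snd g < S N)%nat) /\
  exists t, u <= t <= v /\ near N g (c t).

Definition in_square (p : R * R) : Prop := 0 < fst p < 1 /\ 0 < snd p < 1.

Lemma cell_range N x : (0 < N)%nat -> 0 < x < 1 -> (0 < cell N x < S N)%nat.
Proof.
intros N0 x01; split; [unfold cell; lia|].
assert (H : INR (cell N x) - 1 <= INR N * x) by (apply cell_spec; lra).
assert (0 < INR N) by (apply lt_0_INR; lia).
assert (0 < INR N * (1 - x)) by (apply Rmult_lt_0_compat; lra).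
apply INR_lt; rewrite S_INR; lra.
Qed.

Lemma cell_step N x y : 0 <= x -> 0 <= y -> INR N * Rabs (x - y) < 1 ->
  cell N x = cell N y \/ S (cell N x) = cell N y \/ S (cell N y) = cell N x.
Proof.
intros x0 y0 xy.
pose proof (cell_spec N x x0); pose proof (cell_spec N y y0).
assert (INR N * x < INR N * y + 1 /\ INR N * y < INR N * x + 1) as [? ?].
{ pose proof (pos_INR N); pose proof (Rle_abs (x - y)); pose proof (Rle_abs (- (x - y))).
  rewrite Rabs_Ropp in *; split; nra. }
assert (cell N x < cell N y + 2)%nat
  by (apply INR_lt; rewrite plus_INR; change (INR 2) with (1 + 1); lra).
assert (cell N y < cell N x + 2)%nat
  by (apply INR_lt; rewrite plus_INR; change (INR 2) with (1 + 1); lra).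
lia.
Qed.

Lemma cells_near N p : in_square p -> near N (cells N p) p.
Proof.
intros [p1 p2]; unfold near, cells; cbn [fst snd].
destruct (cell_spec N (fst p)); [lra|]; destruct (cell_spec N (snd p)); [lra|].
split; apply Rabs_le; lra.
Qed.

Lemma trace_joined N c u v : (0 < N)%nat -> cont_pair c ->
  (forall t, unit_I t -> in_square (c t)) -> 0 <= u <= v -> v <= 1 ->
  grid_joined (trace N c u v) (cells N (c u)) (cells N (c v)).
Proof.
intros N0 cc sq uv v1.
assert (NR : 0 < INR N) by (apply lt_0_INR; lia).
apply (interval_ind (fun x y =>
  grid_joined (trace N c u v) (cells N (c x)) (cells N (c y)))); [lra| |].
{ intros; eapply rt_trans; eauto. }
(* Half a cell width around [c s]: the cells of [c x] and [c y] then differ by at most one in each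
   coordinate. *)
intros s Hs; destruct (cont_pair_loc c s (/ (2 * INR N)) cc) as [e [e0 H]];
  [split; lra|apply Rinv_0_lt_compat; lra|].
exists e; split; auto; intros x y xy yv xe ye.
assert (close : INR N * Rabs (fst (c x) - fst (c y)) < 1 /\
                INR N * Rabs (snd (c x) - snd (c y)) < 1).
{ destruct (H x) as [x1 x2]; [split; lra|lra|].
  destruct (H y) as [y1 y2]; [split; lra|lra|].
  assert (tri : forall a b m, Rabs (a - m) < / (2 * INR N) -> Rabs (b - m) < / (2 * INR N) ->
    INR N * Rabs (a - b) < 1).
  { intros a b m am bm. assert (Rabs (a - b) < / INR N).
    { rewrite Rinv_mult in am, bm; revert am bm; unfold Rabs; repeat destruct Rcase_abs; lra. }
    apply Rmult_lt_reg_l with (/ INR N); [apply Rinv_0_lt_compat; lra|].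
    rewrite <- Rmult_assoc, Rinv_l by lra; lra. }
  split; eapply tri; eauto. }
destruct close as [cl1 cl2].
destruct (sq x) as [sx1 sx2]; [split; lra|]; destruct (sq y) as [sy1 sy2]; [split; lra|].
(* The two cells may be diagonal neighbours; [k] replaces the diagonal by two grid steps. *)
set (g := cells N (c x)); set (h := cells N (c y)); set (k := (fst h, snd g)).
assert (trace N c u v g) as Tg.
{ split; [split; apply cell_range; auto|]. exists x; split; [lra|apply cells_near; split; auto]. }
assert (trace N c u v h) as Th.
{ split; [split; apply cell_range; auto|]. exists y; split; [lra|apply cells_near; split; auto]. }
assert (trace N c u v k) as Tk.
{ split; [split; apply cell_range; auto|]. exists y; split; [lra|].
  destruct (cells_near N (c y)) as [n1 _]; [split; auto|]; split; [exact n1|].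
  unfold k, g, cells; cbn [fst snd]; destruct (cell_spec N (snd (c x))); [lra|].
  pose proof (Rle_abs (snd (c x) - snd (c y))); pose proof (Rle_abs (- (snd (c x) - snd (c y)))).
  rewrite Rabs_Ropp in *; apply Rabs_le; nra. }
apply rt_trans with k.
- destruct (cell_step N (fst (c x)) (fst (c y))) as [E|E]; try lra.
  + replace k with g; [apply rt_refl|]. unfold k, g, h, cells; simpl; now rewrite E.
  + apply rt_step; split; [auto|split; [auto|right; split; [reflexivity|exact E]]].
- destruct (cell_step N (snd (c x)) (snd (c y))) as [E|E]; try lra.
  + replace k with h; [apply rt_refl|]. unfold k, g, h, cells; simpl; now rewrite E.
  + apply rt_step; split; [auto|split; [auto|left; split; [reflexivity|exact E]]].
Qed.

(** * Plane drawings give grid minors *)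

Lemma grid_joined_mono (S T : nat * nat -> Prop) p q :
  (forall g, S g -> T g) -> grid_joined S p q -> grid_joined T p q.
Proof.
intros ST; induction 1 as [p q [Sp [Sq pq]]|p|p q r _ IH _ IH'].
- apply rt_step; auto.
- apply rt_refl.
- eapply rt_trans; eauto.
Qed.

Lemma grid_adj_sym p q : grid_adj p q -> grid_adj q p.
Proof. unfold grid_adj; intuition. Qed.

Lemma grid_joined_sym S p q : grid_joined S p q -> grid_joined S q p.
Proof.
induction 1 as [p q [Sp [Sq pq]]|p|p q r _ IH _ IH'].
- apply rt_step; repeat split; auto using grid_adj_sym.
- apply rt_refl.
- eapply rt_trans; eauto.
Qed.

Definition reach (S : nat * nat -> Prop) (r g : nat * nat) : Prop :=
  S g /\ grid_joined S r g.

Lemma reach_joined S r g : S r -> reach S r g -> grid_joined (reach S r) r g.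
Proof.
intros Sr [_ H]; apply clos_rt_rtn1 in H.
induction H as [|p q [Sp [Sq pq]] H IH]; [apply rt_refl|].
apply clos_rtn1_rt in H; eapply rt_trans; [exact IH|].
apply rt_step; repeat split; auto.
eapply rt_trans; [exact H|apply rt_step; auto].
Qed.

(** Along a path from [r] to [g], the points before the first visit to [W] lie in one component of
    [S] minus [W]; the last of them is [p]. *)
Lemma first_entry (S W : nat * nat -> Prop) r g :
  S r -> ~ W r -> W g -> grid_joined S r g ->
  exists p q, reach (fun h => S h /\ ~ W h) r p /\ W q /\ grid_adj p q.
Proof.
intros Sr Wr Wg H; apply clos_rt_rtn1 in H.
assert (reach (fun h => S h /\ ~ W h) r g \/
  exists p q, reach (fun h => S h /\ ~ W h) r p /\ W q /\ grid_adj p q)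
  as [[[_ F] _]|]; auto; [|tauto].
clear Wg; induction H as [|p q [Sp [Sq pq]] H [IH|IH]]; auto.
- left; split; [auto|apply rt_refl].
- destruct (classic (W q)) as [Wq|Wq].
  + right; exists p, q; auto.
  + left; split; auto. destruct IH as [? ?].
    eapply rt_trans; [eassumption|apply rt_step; auto].
Qed.

Lemma uniform_min {A : Type} (Q : A -> R -> Prop) (l : list A) :
  (forall x d d', Q x d -> 0 < d' <= d -> Q x d') ->
  (forall x, exists d, 0 < d /\ Q x d) ->
  exists d, 0 < d /\ forall x, In x l -> Q x d.
Proof.
intros mono H; induction l as [|x l [d [d0 IH]]].
- exists 1; split; [lra|contradiction].
- destruct (H x) as [d' [d0' Hd']].
  exists (Rmin d d'); split; [apply Rmin_glb_lt; lra|].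
  pose proof (Rmin_l d d'); pose proof (Rmin_r d d').
  assert (0 < Rmin d d') by (apply Rmin_glb_lt; lra).
  intros y [<-|Hy]; [apply mono with d'|apply mono with d]; auto; lra.
Qed.

(** Every edge curve is cut in three: the first third goes to the black end, the last to the white
    end, and the middle third, which meets no other edge, is shared between them. *)
Definition third (j : nat) : R := INR j / 3.
Definition in_third (j : nat) (t : R) : Prop := third j <= t <= third (S j).

Lemma third_bounds j : (j < 3)%nat -> 0 <= third j <= third (S j) /\ third (S j) <= 1.
Proof. intros H; unfold third; destruct j as [|[|[|j]]]; simpl; lra || lia. Qed.

Section BipartiteDrawing.
Variables (n : nat) (E : nat -> nat -> Prop) (c : nat -> nat -> R -> R * R).
Variables (pa pb : nat -> R * R).
Hypothesis E_lt : forall a b, E a b -> (a < n)%nat /\ (b < n)%nat.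
Hypothesis c_cont : forall a b, E a b -> cont_pair (c a b).
Hypothesis c_square : forall a b t, E a b -> unit_I t -> in_square (c a b t).
Hypothesis c_start : forall a b, E a b -> c a b 0 = pa a.
Hypothesis c_end : forall a b, E a b -> c a b 1 = pb b.
Hypothesis c_cross : forall a b a' b' s t, E a b -> E a' b' -> unit_I s -> unit_I t ->
  c a b s = c a' b' t ->
  (a = a' /\ b = b' /\ s = t) \/ (a = a' /\ s = 0 /\ t = 0) \/ (b = b' /\ s = 1 /\ t = 1).

Definition disjoint_thirds a b j a' b' j' : Prop :=
  forall s t, in_third j s -> in_third j' t -> c a b s <> c a' b' t.

(** There are finitely many pairs of thirds, because [E_lt] bounds the vertices, so the distances
    from [separated] have a positive minimum. *)
Lemma uniform_separation : exists d, 0 < d /\ forall a b j a' b' j',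
  E a b -> E a' b' -> (j < 3)%nat -> (j' < 3)%nat -> disjoint_thirds a b j a' b' j' ->
  forall s t, in_third j s -> in_third j' t -> far d (c a b s) (c a' b' t).
Proof.
set (idx := list_prod (list_prod (seq 0 n) (seq 0 n)) (seq 0 3)).
destruct (uniform_min (fun x d => let '((a, b, j), (a', b', j')) := x in
  E a b -> E a' b' -> (j < 3)%nat -> (j' < 3)%nat -> disjoint_thirds a b j a' b' j' ->
  forall s t, in_third j s -> in_third j' t -> far d (c a b s) (c a' b' t))
  (list_prod idx idx)) as [d [d0 Hd]].
- intros [[[a b] j] [[a' b'] j']] d d' H dd' h1 h2 h3 h4 h5 s t hs ht.
  apply far_weaken with d; [lra|auto].
- intros [[[a b] j] [[a' b'] j']].
  destruct (classic (E a b /\ E a' b' /\ (j < 3)%nat /\ (j' < 3)%nat /\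
                     disjoint_thirds a b j a' b' j')) as [[h1 [h2 [h3 [h4 h5]]]]|no].
  + destruct (third_bounds j h3), (third_bounds j' h4).
    destruct (separated (c a b) (c a' b') (third j) (third (S j)) (third j') (third (S j')))
      as [d [d0 Hd]]; auto.
    exists d; auto.
  + exists 1; split; [lra|tauto].
- exists d; split; auto; intros a b j a' b' j' h1 h2 h3 h4.
  apply (Hd (a, b, j, (a', b', j'))); auto.
  destruct (E_lt _ _ h1), (E_lt _ _ h2).
  unfold idx; rewrite !in_prod_iff, !in_seq; lia.
Qed.

Section FineGrid.
Variables (d : R) (N : nat).
Hypothesis d_gt0 : 0 < d.
Hypothesis d_sep : forall a b j a' b' j',
  E a b -> E a' b' -> (j < 3)%nat -> (j' < 3)%nat -> disjoint_thirds a b j a' b' j' ->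
  forall s t, in_third j s -> in_third j' t -> far d (c a b s) (c a' b' t).
Hypothesis N_large : 4 < INR N * d.

Definition strand a b j : nat * nat -> Prop := trace N (c a b) (third j) (third (S j)).

(** Two curve points near the same grid point differ by at most [4 / N < d] in each coordinate,
    which [d_sep] forbids for disjoint thirds. *)
Lemma strands_disjoint a b j a' b' j' g : E a b -> E a' b' -> (j < 3)%nat -> (j' < 3)%nat ->
  strand a b j g -> strand a' b' j' g ->
  exists s t, in_third j s /\ in_third j' t /\ c a b s = c a' b' t.
Proof.
intros h1 h2 h3 h4 [_ [s [Hs [n1 n2]]]] [_ [t [Ht [m1 m2]]]].
apply NNPP; intros no.
assert (far d (c a b s) (c a' b' t)) as F.
{ apply (d_sep a b j a' b' j'); auto. intros s' t' Hs' Ht' eq; apply no; exists s', t'; auto. }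
assert (K : forall x y z, Rabs (z - INR N * x) <= 2 -> Rabs (z - INR N * y) <= 2 ->
  ~ d <= Rabs (x - y)).
{ intros x y z hx hy far.
  assert (0 <= INR N) by apply pos_INR.
  assert (INR N * d <= INR N * Rabs (x - y)) by (apply Rmult_le_compat_l; auto).
  rewrite <- (Rabs_pos_eq (INR N)) in H0 at 2 by auto.
  rewrite <- Rabs_mult, Rmult_minus_distr_l in H0.
  revert hx hy H0; unfold Rabs; repeat destruct Rcase_abs; lra. }
destruct F as [F|F]; revert F; eapply K; eauto.
Qed.

Lemma strand_joined a b j : E a b -> (j < 3)%nat ->
  grid_joined (strand a b j) (cells N (c a b (third j))) (cells N (c a b (third (S j)))).
Proof.
intros Eab j3; destruct (third_bounds j j3).
apply trace_joined; auto.
assert (0 < INR N) by (apply Rnot_le_lt; intros l; pose proof (pos_INR N); nra).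
apply INR_lt; auto.
Qed.

Lemma strand_cell a b j t : E a b -> (j < 3)%nat -> in_third j t ->
  strand a b j (cells N (c a b t)).
Proof.
intros Eab j3 Ht; destruct (third_bounds j j3).
assert (0 < N)%nat.
{ apply INR_lt, Rnot_le_lt; intros l; pose proof (pos_INR N); simpl in l; nra. }
assert (in_square (c a b t)) as sq by (unfold in_third in Ht; apply c_square; auto; split; lra).
split; [split; apply cell_range; auto; apply sq|].
exists t; split; auto; apply cells_near; auto.
Qed.

(** Taking the component of the cell of [pb b] in each last third makes the union connected by
    construction, as all pieces share that cell. *)
Definition white_set (b : nat) (g : nat * nat) : Prop :=
  exists a, E a b /\ reach (strand a b 2) (cells N (pb b)) g.

Definition strand_before a b (g : nat * nat) : Prop := strand a b 1 g /\ ~ white_set b g.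

(* The whole part of the middle third before the first meeting with the white
   set is given to the black set, so that one grid segment remains between. *)
Definition black_set (a : nat) (g : nat * nat) : Prop :=
  exists b, E a b /\ (reach (strand a b 0) (cells N (pa a)) g \/
                      reach (strand_before a b) (cells N (c a b (third 1))) g).

Lemma black_strand a g : black_set a g ->
  exists b j, E a b /\ (j < 2)%nat /\ strand a b j g /\ (j = 1%nat -> ~ white_set b g).
Proof.
intros [b [Eab [[H _]|[[H W] _]]]]; [exists b, 0%nat|exists b, 1%nat];
  (split; [exact Eab|split; [lia|split; [exact H|]]]); [discriminate|auto].
Qed.

Lemma thirdE : third 0 = 0 /\ third 1 = 1 / 3 /\ third 2 = 2 / 3 /\ third 3 = 1.
Proof. unfold third; simpl; lra. Qed.

Lemma in_third_unit j t : (j < 3)%nat -> in_third j t -> unit_I t.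
Proof. intros j3 [? ?]; destruct (third_bounds j j3); split; lra. Qed.

(** A common grid point makes the curves meet. A common end is excluded by the thirds involved, so
    the edges agree; then only the middle third can touch the last one, and [strand_before] has
    removed the white points from it. *)
Lemma black_white_disjoint a b g : black_set a g -> white_set b g -> False.
Proof.
intros Ba Wb; destruct (black_strand _ _ Ba) as [b' [j [Eab [j2 [Hj Wj]]]]].
pose proof Wb as [a' [Ea'b [H2 _]]]; destruct thirdE as [t0 [t1 [t2 t3]]].
destruct (strands_disjoint a b' j a' b 2 g) as [s [t [Hs [Ht eq]]]]; auto.
assert (us : unit_I s) by (apply (in_third_unit j); auto; lia).
assert (ut : unit_I t) by (apply (in_third_unit 2); auto).
unfold in_third in *; destruct (c_cross _ _ _ _ _ _ Eab Ea'b us ut eq)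
  as [[-> [-> st]]|[[-> [s0 s0']]|[-> [s1 _]]]].
- destruct j as [|[|]]; try lia; [lra|exact (Wj eq_refl Wb)].
- lra.
- destruct j as [|[|]]; try lia; lra.
Qed.

Lemma black_disjoint a a' g : black_set a g -> black_set a' g -> a = a'.
Proof.
intros Ba Ba'; destruct (black_strand _ _ Ba) as [b [j [Eab [j2 [Hj _]]]]].
destruct (black_strand _ _ Ba') as [b' [j' [Eab' [j2' [Hj' _]]]]].
destruct thirdE as [t0 [t1 [t2 t3]]].
destruct (strands_disjoint a b j a' b' j' g) as [s [t [Hs [Ht eq]]]]; auto; try lia.
assert (us : unit_I s) by (apply (in_third_unit j); auto; lia).
assert (ut : unit_I t) by (apply (in_third_unit j'); auto; lia).
unfold in_third in *; destruct (c_cross _ _ _ _ _ _ Eab Eab' us ut eq)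
  as [[? _]|[[? _]|[_ [s1 _]]]]; auto.
destruct j as [|[|]]; try lia; lra.
Qed.

Lemma white_disjoint b b' g : white_set b g -> white_set b' g -> b = b'.
Proof.
intros [a [Eab [H _]]] [a' [Eab' [H' _]]]; destruct thirdE as [t0 [t1 [t2 t3]]].
destruct (strands_disjoint a b 2 a' b' 2 g) as [s [t [Hs [Ht eq]]]]; auto.
assert (us : unit_I s) by (apply (in_third_unit 2); auto).
assert (ut : unit_I t) by (apply (in_third_unit 2); auto).
unfold in_third in *; destruct (c_cross _ _ _ _ _ _ Eab Eab' us ut eq)
  as [[_ [? _]]|[[_ [s0 _]]|[? _]]]; auto; lra.
Qed.

Lemma white_root b g : white_set b g -> grid_joined (white_set b) (cells N (pb b)) g.
Proof.
intros [a [Eab H]]; destruct thirdE as [t0 [t1 [t2 t3]]].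
apply grid_joined_mono with (reach (strand a b 2) (cells N (pb b))).
{ intros h Hh; exists a; auto. }
apply reach_joined; auto.
rewrite <- (c_end a b Eab); apply strand_cell; auto; split; lra.
Qed.

Lemma middle_start_black a b : E a b ->
  reach (strand a b 0) (cells N (pa a)) (cells N (c a b (third 1))).
Proof.
intros Eab; destruct thirdE as [t0 [t1 [t2 t3]]]; split.
- apply strand_cell; auto; split; lra.
- rewrite <- (c_start a b Eab), <- t0; apply strand_joined; auto.
Qed.

(** The cell at parameter 1/3 is already black through the first third, hence not white. *)
Lemma middle_start_before a b : E a b -> strand_before a b (cells N (c a b (third 1))).
Proof.
intros Eab; destruct thirdE as [t0 [t1 [t2 t3]]]; split.
- apply strand_cell; auto; split; lra.
- intros W; apply (black_white_disjoint a b (cells N (c a b (third 1)))); auto.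
  exists b; split; auto; left; apply middle_start_black; auto.
Qed.

Lemma black_root a g : black_set a g -> grid_joined (black_set a) (cells N (pa a)) g.
Proof.
destruct thirdE as [t0 [t1 [t2 t3]]].
assert (first : forall b h, E a b -> reach (strand a b 0) (cells N (pa a)) h ->
  grid_joined (black_set a) (cells N (pa a)) h).
{ intros b h Eab H.
  apply grid_joined_mono with (reach (strand a b 0) (cells N (pa a))).
  { intros k Hk; exists b; auto. }
  apply reach_joined; auto.
  rewrite <- (c_start a b Eab); apply strand_cell; auto; split; lra. }
intros [b [Eab [H|H]]]; [eapply first; eauto|].
apply rt_trans with (cells N (c a b (third 1))).
- eapply first; eauto; apply middle_start_black; auto.
- apply grid_joined_mono with (reach (strand_before a b) (cells N (c a b (third 1)))).
  { intros k Hk; exists b; auto. }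
  apply reach_joined; auto; apply middle_start_before; auto.
Qed.

(** The cell at parameter 2/3 is white through the last third, so the middle strand runs from a
    black cell into the white set, and its first entry gives the adjacent pair. *)
Lemma black_meets_white a b : E a b ->
  exists p q, black_set a p /\ white_set b q /\ grid_adj p q.
Proof.
intros Eab; destruct thirdE as [t0 [t1 [t2 t3]]].
destruct (middle_start_before a b Eab) as [S1 W1].
destruct (first_entry (strand a b 1) (white_set b) (cells N (c a b (third 1)))
  (cells N (c a b (third 2)))) as [p [q [Hp [Hq pq]]]]; auto.
- exists a; split; auto; split; [apply strand_cell; auto; split; lra|].
  apply grid_joined_sym; rewrite <- (c_end a b Eab), <- t3; apply strand_joined; auto.
- apply strand_joined; auto.
- exists p, q; split; auto; exists b; auto.
Qed.

Lemma fine_grid_minor : grid_minor n E.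
Proof.
assert (range : forall (s : bool) i p, (if s then white_set i else black_set i) p ->
  (0 < fst p < S N)%nat /\ (0 < snd p < S N)%nat).
{ intros [|] i p H.
  - destruct H as [a [_ [[? _] _]]]; auto.
  - destruct (black_strand _ _ H) as [b [j [_ [_ [[? _] _]]]]]; auto. }
exists (S N), (fun s : bool => if s then white_set else black_set); split; [|split; [|split]].
- intros [|]; [apply (range true)|apply (range false)].
- intros [|] i [|] i' p H H'; (split; [try reflexivity|]);
    try solve [exfalso; eauto using black_white_disjoint];
    eauto using white_disjoint, black_disjoint.
- intros [|] i p q Hp Hq.
  + eapply rt_trans; [apply grid_joined_sym, white_root; auto|apply white_root; auto].
  + eapply rt_trans; [apply grid_joined_sym, black_root; auto|apply black_root; auto].
- intros a b _ _; apply black_meets_white.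
Qed.
End FineGrid.

Lemma drawing_grid_minor : grid_minor n E.
Proof.
destruct uniform_separation as [d [d0 Hd]].
destruct (INR_unbounded (4 / d)) as [N HN].
apply fine_grid_minor with d N; auto.
apply Rmult_lt_reg_r with (/ d); [apply Rinv_0_lt_compat; auto|].
rewrite Rmult_assoc, Rinv_r by lra; unfold Rdiv in HN; lra.
Qed.
End BipartiteDrawing.

(** * Squashing the plane into the open unit square *)

Definition squash (x : R) : R := atan x / PI + 1 / 2.
Definition squash2 (p : R * R) : R * R := (squash (fst p), squash (snd p)).

Lemma squash_inj x y : squash x = squash y -> x = y.
Proof.
unfold squash; intros H; pose proof PI_RGT_0.
rewrite <- (tan_atan x), <- (tan_atan y); f_equal.
apply Rmult_eq_reg_r with (/ PI); [unfold Rdiv in H; lra|].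
apply Rinv_neq_0_compat; lra.
Qed.

Lemma squash2_inj p q : squash2 p = squash2 q -> p = q.
Proof.
destruct p, q; unfold squash2; simpl; intros [= h1 h2]; f_equal; apply squash_inj; auto.
Qed.

Lemma squash_range x : 0 < squash x < 1.
Proof.
unfold squash; pose proof PI_RGT_0; pose proof (atan_bound x) as [h1 h2].
assert (- (1 / 2) < atan x / PI < 1 / 2); [|lra].
split; apply Rmult_lt_reg_r with PI; auto; unfold Rdiv; rewrite (Rmult_assoc _ (/ PI)), Rinv_l; lra.
Qed.

Lemma cont01_squash f : cont01 f -> cont01 (fun t => squash (f t)).
Proof.
intros cf t ut.
assert (cs : continuity_pt squash (f t)).
{ unfold squash; apply continuity_pt_plus; [|apply continuity_pt_const; intros ? ?; auto].
  apply continuity_pt_mult; [|apply continuity_pt_const; intros ? ?; auto].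
  apply derivable_continuous_pt, derivable_pt_atan. }
intros e e0; destruct (cs e e0) as [d [d0 Hd]]; destruct (cf t ut d d0) as [d' [d0' Hd']].
exists d'; split; auto; intros s Hs.
(* [continuity_pt] only speaks of points different from [f t]. *)
destruct (Req_dec (f t) (f s)) as [eq|ne].
- rewrite eq; simpl; rewrite Rdist_eq; auto.
- apply Hd; split; [split; [exact I|auto]|apply Hd'; auto].
Qed.

(** The clauses of [planar] on vertices, on interiors avoiding vertices and on disjoint interiors
    merge into the crossing hypothesis of the section, by asking whether each parameter is 0, 1 or
    interior. *)
Lemma planar_grid_minor (V : Type) (P : V -> Prop) (SE : V -> V -> Prop) (n : nat)
    (bl wh : nat -> V) :
  planar P SE -> (forall x y, SE x y -> P x /\ P y) ->
  (forall a b, bl a = bl b -> a = b) -> (forall a b, wh a = wh b -> a = b) ->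
  (forall a b, bl a <> wh b) ->
  grid_minor n (fun a b => (a < n)%nat /\ (b < n)%nat /\ SE (bl a) (wh b)).
Proof.
intros [pos [path [inj [arcs [avoid cross]]]]] SEP blI whI blwh.
apply drawing_grid_minor with (c := fun a b t => squash2 (path (bl a) (wh b) t))
  (pa := fun a => squash2 (pos (bl a))) (pb := fun b => squash2 (pos (wh b))).
- tauto.
- intros a b [_ [_ H]]; destruct (SEP _ _ H) as [Pa Pb].
  destruct (arcs _ _ Pa Pb H) as [c1 [c2 _]].
  split; [apply (cont01_squash _ c1)|apply (cont01_squash _ c2)].
- intros a b t _ _; split; apply squash_range.
- intros a b [_ [_ H]]; destruct (SEP _ _ H) as [Pa Pb].
  destruct (arcs _ _ Pa Pb H) as [_ [_ [-> _]]]; auto.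
- intros a b [_ [_ H]]; destruct (SEP _ _ H) as [Pa Pb].
  destruct (arcs _ _ Pa Pb H) as [_ [_ [_ [-> _]]]]; auto.
- intros a b a' b' s t [_ [_ H]] [_ [_ H']] us ut eq; apply squash2_inj in eq.
  destruct (SEP _ _ H) as [Pa Pb], (SEP _ _ H') as [Pa' Pb'].
  destruct (arcs _ _ Pa Pb H) as [_ [_ [s0 [s1 si]]]].
  destruct (arcs _ _ Pa' Pb' H') as [_ [_ [t0 [t1 ti]]]].
  assert (ends : forall r, unit_I r -> r = 0 \/ r = 1 \/ open_I r).
  { intros r [r1 r2]; unfold open_I; lra. }
  destruct (ends s us) as [->|[->|os]].
  + rewrite s0 in eq; destruct (ends t ut) as [->|[->|ot]].
    * rewrite t0 in eq; apply inj in eq; auto.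
    * rewrite t1 in eq; apply inj in eq; auto; exfalso; eapply blwh; eauto.
    * exfalso; apply (avoid (bl a') (wh b') (bl a) t); auto.
  + rewrite s1 in eq; destruct (ends t ut) as [->|[->|ot]].
    * rewrite t0 in eq; apply inj in eq; auto; exfalso; eapply blwh; eauto.
    * rewrite t1 in eq; apply inj in eq; auto 6.
    * exfalso; apply (avoid (bl a') (wh b') (wh b) t); auto.
  + destruct (ends t ut) as [->|[->|ot]].
    * rewrite t0 in eq; exfalso; apply (avoid (bl a) (wh b) (bl a') s); auto.
    * rewrite t1 in eq; exfalso; apply (avoid (bl a) (wh b) (wh b') s); auto.
    * destruct (classic (bl a = bl a' /\ wh b = wh b')) as [[e1 e2]|ne].
      -- apply blI in e1; apply whI in e2; subst; left; auto.
      -- exfalso; apply (cross (bl a) (wh b) (bl a') (wh b') s t); auto.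
         intros [?|[e1 _]]; [auto|eapply blwh; eauto].
Qed.

(** * Planar layers covering the product *)

Lemma planar_pullback (V W : Type) (P : V -> Prop) (E : V -> V -> Prop)
    (Q : W -> Prop) (F : W -> W -> Prop) (f : W -> V) :
  (forall x, Q x -> P (f x)) -> (forall x y, Q x -> Q y -> f x = f y -> x = y) ->
  (forall x y, F x y -> E (f x) (f y)) -> planar P E -> planar Q F.
Proof.
intros QP inj FE [pos [path [pinj [arcs [avoid cross]]]]].
exists (fun x => pos (f x)), (fun x y => path (f x) (f y)); split; [|split; [|split]].
- auto.
- intros x y Qx Qy Fxy; apply arcs; auto.
- intros x y z t Qx Qy Qz Fxy; apply avoid; auto.
- intros x y x' y' s t Qx Qy Qx' Qy' Fxy Fxy' ne; apply cross; auto.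
  intros [[h1 h2]|[h1 h2]]; apply ne; [left|right]; auto.
Qed.

Inductive quad := Q0 | Q1 | Q2 | Q3.

Definition next (q : quad) : quad :=
  match q with Q0 => Q1 | Q1 => Q2 | Q2 => Q3 | Q3 => Q0 end.

Definition rot (q : quad) (p : R * R) : R * R :=
  match q with
  | Q0 => p
  | Q1 => (- snd p, fst p)
  | Q2 => (- fst p, - snd p)
  | Q3 => (snd p, - fst p)
  end.

(** Vertices of one infinite plane graph, with infinitely many bundle places in each quadrant, from
    which every layer is pulled back whatever [n] is. *)
Inductive spot := Outer (q : quad) | Inner (q : quad) | Bundle (q : quad) (m : nat).

(** Position on the diagonal from (3, 0) to (0, 1) of the face between the squares. Adding 2 keeps
    it strictly below 1, so no bundle vertex hits the end (0, 1). *)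
Definition ratio (m : nat) : R := / (INR m + 2).

Definition spot_pos (u : spot) : R * R :=
  match u with
  | Outer q => rot q (3, 0)
  | Inner q => rot q (1, 0)
  | Bundle q m => rot q (3 * (1 - ratio m), ratio m)
  end.

(** A vertex or open edge in the half-open quadrant [0 < x], [0 <= y]. The four rotations of this
    quadrant partition the punctured plane, so the geometry is done once. *)
Inductive feature :=
  | AtOuter | AtInner | AtBundle (m : nat)
  | Spoke | OuterSide | InnerSide | ToOuter (m : nat) | ToInner (m : nat).

Definition occupies (f : feature) (x y : R) : Prop :=
  match f with
  | AtOuter => x = 3 /\ y = 0
  | AtInner => x = 1 /\ y = 0
  | AtBundle m => x = 3 * (1 - ratio m) /\ y = ratio m
  | Spoke => 1 < x < 3 /\ y = 0
  | OuterSide => 0 < x /\ 0 < y /\ x + y = 3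
  | InnerSide => 0 < x /\ 0 < y /\ x + y = 1
  | ToOuter m => 0 < x /\ 0 < y /\ x + y < 3 /\ 3 < x + 3 * y /\
                 x * (3 - ratio m) = 3 * (1 - ratio m) * (3 - y)
  | ToInner m => 0 < x /\ 0 < y /\ 1 < x + y /\ x + 3 * y < 3 /\
                 ratio m * (x - 1) = (2 - 3 * ratio m) * y
  end.

(** An oriented edge, with the quadrant and the feature in which it is drawn. These two determine
    the edge ([link_det]), which reduces disjointness of edges to [rot_inj] and [occupies_inj]. *)
Inductive link : spot -> spot -> quad -> feature -> Prop :=
  | link_spoke q : link (Outer q) (Inner q) q Spoke
  | link_outer q : link (Outer q) (Outer (next q)) q OuterSide
  | link_inner q : link (Inner q) (Inner (next q)) q InnerSide
  | link_to_outer q m : link (Bundle q m) (Outer (next q)) q (ToOuter m)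
  | link_to_inner q m : link (Bundle q m) (Inner q) q (ToInner m).

Definition spot_adj (u v : spot) : Prop :=
  exists q f, link u v q f \/ link v u q f.

Lemma ratio_bounds m : 0 < ratio m < 1.
Proof.
unfold ratio; pose proof (pos_INR m); split; [apply Rinv_0_lt_compat; lra|].
rewrite <- Rinv_1; apply Rinv_lt_contravar; lra.
Qed.

Lemma ratio_inj m m' : ratio m = ratio m' -> m = m'.
Proof.
unfold ratio; intros H; apply Rinv_eq_reg in H; apply INR_eq; lra.
Qed.

Lemma occupies_quadrant f x y : occupies f x y -> 0 < x /\ 0 <= y.
Proof. destruct f as [| |m| | | |m|m]; simpl; try lra; pose proof (ratio_bounds m); lra. Qed.

Lemma occupies_inj f f' x y : occupies f x y -> occupies f' x y -> f = f'.
Proof.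
destruct f as [| |m| | | |m|m], f' as [| |m'| | | |m'|m']; simpl; intros H H';
  try reflexivity; try (exfalso; lra);
  try (pose proof (ratio_bounds m)); try (pose proof (ratio_bounds m'));
  try (exfalso; lra); try (exfalso; nra);
  f_equal; apply ratio_inj; try lra.
(* Each line equation is linear in the ratio; the factor is its coefficient, positive inside the
   face. *)
- apply Rmult_eq_reg_r with (9 - 3 * y - x); lra.
- apply Rmult_eq_reg_r with (x - 1 + 3 * y); lra.
Qed.

Lemma rot_inj q q' x y x' y' : 0 < x /\ 0 <= y -> 0 < x' /\ 0 <= y' ->
  rot q (x, y) = rot q' (x', y') -> q = q' /\ x = x' /\ y = y'.
Proof.
intros H H'; destruct q, q'; simpl; intros [= h1 h2]; repeat split; lra.
Qed.

Definition seg (p q : R * R) (t : R) : R * R :=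
  ((1 - t) * fst p + t * fst q, (1 - t) * snd p + t * snd q).

Lemma seg_rot r p q t : seg (rot r p) (rot r q) t = rot r (seg p q t).
Proof. destruct r; unfold seg; simpl; f_equal; ring. Qed.

Lemma rot_next q p : rot (next q) p = rot q (rot Q1 p).
Proof. destruct q, p; simpl; f_equal; ring. Qed.

Lemma seg_rev p q t : seg p q t = seg q p (1 - t).
Proof. unfold seg; f_equal; ring. Qed.

Lemma spot_occupies u : exists q f x y,
  spot_pos u = rot q (x, y) /\ occupies f x y /\
  (f = AtOuter \/ f = AtInner \/ exists m, f = AtBundle m).
Proof.
destruct u as [q|q|q m]; simpl.
- exists q, AtOuter, 3, 0; repeat split; auto.
- exists q, AtInner, 1, 0; repeat split; auto.
- exists q, (AtBundle m), (3 * (1 - ratio m)), (ratio m); repeat split; eauto.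
Qed.

Lemma spot_pos_inj u v : spot_pos u = spot_pos v -> u = v.
Proof.
destruct u as [q|q|q m], v as [q'|q'|q' m']; simpl; intros H;
  try (pose proof (ratio_bounds m)); try (pose proof (ratio_bounds m'));
  apply rot_inj in H; try lra; destruct H as [-> [h1 h2]]; try lra; auto.
f_equal; apply ratio_inj; auto.
Qed.

Lemma link_occupies u v q f t : link u v q f -> open_I t -> exists x y,
  seg (spot_pos u) (spot_pos v) t = rot q (x, y) /\ occupies f x y.
Proof.
intros L [t0 t1]; destruct L as [q|q|q|q m|q m]; simpl;
  rewrite ?rot_next, seg_rot; do 2 eexists; (split; [reflexivity|]); simpl;
  try (pose proof (ratio_bounds m)); repeat split; try nra.
Qed.

Lemma link_edge_feature u v q f : link u v q f ->
  f <> AtOuter /\ f <> AtInner /\ forall m, f <> AtBundle m.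
Proof. destruct 1; repeat split; discriminate. Qed.

Lemma link_irrefl u v q f : link u v q f -> u <> v.
Proof. destruct 1; try discriminate; intros [= H]; destruct q; discriminate. Qed.

Lemma link_det u v u' v' q f : link u v q f -> link u' v' q f -> u = u' /\ v = v'.
Proof. destruct 1; inversion 1; subst; auto. Qed.

Lemma spot_adj_seg u v t : spot_adj u v -> open_I t -> exists q f x y,
  seg (spot_pos u) (spot_pos v) t = rot q (x, y) /\ occupies f x y /\
  (link u v q f \/ link v u q f).
Proof.
intros [q [f [L|L]]] ot.
- destruct (link_occupies _ _ _ _ _ L ot) as [x [y [? ?]]].
  exists q, f, x, y; auto.
- assert (ot' : open_I (1 - t)) by (unfold open_I in *; lra).
  destruct (link_occupies _ _ _ _ _ L ot') as [x [y [? ?]]].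
  exists q, f, x, y; rewrite seg_rev; auto.
Qed.

Lemma cont01_affine a b : cont01 (fun t => (1 - t) * a + t * b).
Proof.
intros t ut; apply (limit1_imp _ no_cond); [intros; exact I|].
assert (C : continuity (fun t => (1 - t) * a + t * b)) by reg.
intros e e0; destruct (C t e e0) as [d [d0 Hd]]; exists d; split; auto.
intros s [_ Hs]; destruct (Req_dec t s) as [<-|ne].
- simpl; rewrite Rdist_eq; auto.
- apply Hd; repeat split; auto.
Qed.

Lemma seg_arc p q : p <> q -> arc (seg p q) p q.
Proof.
intros ne; split; [apply cont01_affine|split; [apply cont01_affine|]].
destruct p as [a b], q as [a' b']; unfold seg; simpl; repeat split.
- f_equal; ring.
- f_equal; ring.
- intros s t _ _ [= h1 h2].
  apply NNPP; intros st; apply ne.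
  f_equal; apply Rmult_eq_reg_l with (s - t); lra.
Qed.

(** Coinciding points of the straight-line drawing have the same quadrant and feature; a vertex
    feature is never an edge feature, and equal edge features belong to one edge. *)
Lemma spot_planar : planar (fun _ => True) spot_adj.
Proof.
exists spot_pos, (fun u v => seg (spot_pos u) (spot_pos v)); split; [|split; [|split]].
- intros u v _ _; apply spot_pos_inj.
- intros u v _ _ uv; apply seg_arc; intros H; apply spot_pos_inj in H; subst.
  destruct uv as [q [f [L|L]]]; apply link_irrefl in L; auto.
- intros u v z t _ _ _ uv ot H.
  destruct (spot_adj_seg u v t uv ot) as [q [f [x [y [E [O L]]]]]].
  destruct (spot_occupies z) as [q' [f' [x' [y' [E' [O' V]]]]]].
  rewrite E, E' in H; apply rot_inj in H; eauto using occupies_quadrant.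
  destruct H as [-> [-> ->]]; pose proof (occupies_inj _ _ _ _ O O'); subst f'.
  assert (f <> AtOuter /\ f <> AtInner /\ forall m, f <> AtBundle m) as [n1 [n2 n3]].
  { destruct L as [L|L]; eapply link_edge_feature; eauto. }
  destruct V as [?|[?|[m ?]]]; auto; eapply n3; eauto.
- intros u v u' v' s t _ _ _ _ uv uv' ne os ot H.
  destruct (spot_adj_seg u v s uv os) as [q [f [x [y [E [O L]]]]]].
  destruct (spot_adj_seg u' v' t uv' ot) as [q' [f' [x' [y' [E' [O' L']]]]]].
  rewrite E, E' in H; apply rot_inj in H; eauto using occupies_quadrant.
  destruct H as [-> [-> ->]]; pose proof (occupies_inj _ _ _ _ O O'); subst f'.
  apply ne; destruct L as [L|L], L' as [L'|L'];
    destruct (link_det _ _ _ _ _ _ L L') as [-> ->]; auto.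
Qed.

(* [corner] and [bundle_quad] are chosen so that for vertices (a, s), (b, t) with
   s <> t in different blocks, either the bundle of (b, t) in the layer of a has
   (a, s) as an end, or the bundle of (a, s) in the layer of b has (b, t). *)
Definition corner (side i : nat) : spot :=
  match side, i with
  | 0, 0 => Outer Q0 | 0, 1 => Inner Q3 | 0, 2 => Inner Q1 | 0, _ => Outer Q2
  | _, 0 => Inner Q2 | _, 1 => Outer Q1 | _, 2 => Outer Q3 | _, _ => Inner Q0
  end%nat.

Definition bundle_quad (side i : nat) : quad :=
  match side, i with
  | 0, 0 => Q2 | 0, 1 => Q2 | 0, _ => Q0
  | _, 0 => Q1 | _, 1 => Q3 | _, 2 => Q1 | _, _ => Q3
  end%nat.

Definition layer_spot (r : nat) (x : nat * nat) : spot :=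
  if (fst x / 4 =? r)%nat then corner (snd x) (fst x mod 4)
  else Bundle (bundle_quad (snd x) (fst x mod 4)) (fst x).

(** Black bundles use the quadrants [Q0] and [Q2], white ones [Q1] and [Q3], so the vertex number
    can serve as index within a bundle. *)
Lemma layer_spot_inj r x y : (snd x < 2)%nat -> (snd y < 2)%nat ->
  layer_spot r x = layer_spot r y -> x = y.
Proof.
destruct x as [a s], y as [b t]; unfold layer_spot; cbn [fst snd]; intros s2 t2.
pose proof (Nat.div_mod_eq a 4) as Ea; pose proof (Nat.div_mod_eq b 4) as Eb.
assert (a mod 4 < 4)%nat by (apply Nat.mod_upper_bound; lia).
assert (b mod 4 < 4)%nat by (apply Nat.mod_upper_bound; lia).
destruct (Nat.eqb_spec (a / 4) r) as [ra|ra], (Nat.eqb_spec (b / 4) r) as [rb|rb].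
- intros H1; assert (a mod 4 = b mod 4 /\ s = t)%nat as [h ->].
  { destruct s as [|[|]], t as [|[|]]; try lia;
      destruct (a mod 4) as [|[|[|[|]]]]; try lia;
      destruct (b mod 4) as [|[|[|[|]]]]; try lia; discriminate || auto. }
  f_equal; lia.
- destruct s as [|[|]]; try lia; destruct (a mod 4) as [|[|[|]]]; discriminate.
- destruct t as [|[|]]; try lia; destruct (b mod 4) as [|[|[|]]]; discriminate.
- intros H1; assert (a = b) by congruence; subst b; f_equal.
  assert (hq : bundle_quad s (a mod 4) = bundle_quad t (a mod 4)) by congruence.
  destruct s as [|[|]], t as [|[|]]; try lia;
    destruct (a mod 4) as [|[|[|]]]; discriminate hq.
Qed.

(** Within a block, [K_4 x K_2] is the cube in which the two copies of a vertex are antipodes.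
    Across blocks, the residues modulo 4 decide which of the two layers carries the edge. *)
Lemma layer_cover a b s t : a <> b -> (s < 2)%nat -> (t < 2)%nat -> s <> t ->
  exists r, (r = a / 4 \/ r = b / 4)%nat /\
    spot_adj (layer_spot r (a, s)) (layer_spot r (b, t)).
Proof.
intros ab s2 t2 st; unfold layer_spot; cbn [fst snd].
pose proof (Nat.div_mod_eq a 4) as Ea; pose proof (Nat.div_mod_eq b 4) as Eb.
assert (a mod 4 < 4)%nat by (apply Nat.mod_upper_bound; lia).
assert (b mod 4 < 4)%nat by (apply Nat.mod_upper_bound; lia).
destruct (Nat.eq_dec (a / 4) (b / 4)) as [eq|ne].
- exists (b / 4)%nat; split; auto; rewrite eq, Nat.eqb_refl.
  assert (a mod 4 <> b mod 4)%nat by lia.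
  destruct s as [|[|]], t as [|[|]]; try lia;
    destruct (a mod 4) as [|[|[|[|]]]]; try lia;
    destruct (b mod 4) as [|[|[|[|]]]]; try lia;
    do 2 eexists; solve [left; constructor|right; constructor|
       left; apply (link_outer Q0)|left; apply (link_outer Q3)].
- assert ((a / 4 =? b / 4 = false)%nat /\ (b / 4 =? a / 4 = false)%nat) as [ne1 ne2].
  { split; apply Nat.eqb_neq; auto. }
  assert (spot_adj (corner s (a mod 4)) (Bundle (bundle_quad t (b mod 4)) b) \/
          spot_adj (Bundle (bundle_quad s (a mod 4)) a) (corner t (b mod 4))) as [K|K].
  { destruct s as [|[|]], t as [|[|]]; try lia;
    destruct (a mod 4) as [|[|[|[|]]]]; try lia;
    destruct (b mod 4) as [|[|[|[|]]]]; try lia; cbn [corner bundle_quad];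
    solve [left; do 2 eexists; right; constructor|right; do 2 eexists; left; constructor]. }
  + exists (a / 4)%nat; split; auto; rewrite Nat.eqb_refl, ne2; auto.
  + exists (b / 4)%nat; split; auto; rewrite Nat.eqb_refl, ne1; auto.
Qed.

(** Layer [r] takes every product edge that [layer_spot r] maps to a drawn edge. Layers may overlap,
    and an incomplete last block merely leaves corners empty. *)
Lemma kron_union_of_planar n : union_of_planar (kron (K n) (K 2)) ((n + 3) / 4).
Proof.
set (G := kron (K n) (K 2)).
exists (fun _ => gvert G), (fun r x y => gadj G x y /\ spot_adj (layer_spot r x) (layer_spot r y)).
assert (div : forall a, (a < n)%nat -> (a / 4 < (n + 3) / 4)%nat).
{ intros a an; apply Nat.Div0.div_lt_upper_bound.
  assert ((n + 3) mod 4 < 4)%nat by (apply Nat.mod_upper_bound; lia).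
  pose proof (Nat.div_mod_eq (n + 3) 4); lia. }
split; [|split; [|split; [|split]]].
- auto.
- intros r x y _ [H _]; repeat split; apply H || exact H.
- intros x Gx; exists 0%nat; split; auto.
  destruct Gx as [Gx _]; apply div in Gx; lia.
- intros [a s] [b t] _ _ H; pose proof H as [an [_ [bn [_ [[_ [_ ab]] [s2 [t2 st]]]]]]].
  destruct (layer_cover a b s t) as [r [Hr L]]; auto.
  exists r; split; [destruct Hr as [-> | ->]; auto|auto].
- intros r _; apply (planar_pullback _ _ _ _ _ _ (layer_spot r)) with (4 := spot_planar).
  + auto.
  + intros x y [_ x2] [_ y2]; apply layer_spot_inj; auto.
  + intros x y [_ H]; auto.
Qed.

(** * Edge bound for bipartite grid minors *)

Module Minor.
Import all_boot all_order all_algebra boolp zify.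
Set Implicit Arguments. Unset Strict Implicit. Unset Printing Implicit Defensive.
Import GRing.Theory.
Local Open Scope ring_scope.

(** * Counting faces by linear algebra *)

Lemma sum0_other (F : fieldType) (I : finType) (P : pred I) (f : I -> F) (k : I) :
  \sum_(j | P j) f j = 0 -> P k -> f k != 0 ->
  exists j, [/\ P j, j != k & f j != 0].
Proof.
move=> sum0 Pk fk_neq0.
have [j /and3P[Pj jk fj]|none] := pickP [pred j | [&& P j, j != k & f j != 0]].
  by exists j.
move: sum0; rewrite (bigD1 k) //= big1 ?addr0; first by move/eqP; rewrite (negPf fk_neq0).
move=> j /andP[Pj jk]; apply/eqP/negPn/negP => fj.
by have := none j; rewrite /= Pj jk fj.
Qed.

(** The support has no vertex of degree one. Extend [k] by [k1] at its black end and by [k2] at its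
    white end, and [k1] by [k3] at its white end; simplicity gives [k] and [k1] different white
    ends, so the four edges are distinct. *)
Lemma bipartite_girth (F : fieldType) n m (ea eb : 'I_m -> 'I_n) (f : 'I_m -> F) :
  (forall k l, ea k = ea l -> eb k = eb l -> k = l) ->
  (forall i, \sum_(k | ea k == i) f k = 0) ->
  (forall i, \sum_(k | eb k == i) f k = 0) ->
  (exists k, f k != 0) -> (4 <= #|[set k | f k != 0%R]|)%N.
Proof.
move=> inj cyca cycb [k fk].
have [k1 [/eqP ak1 k1k fk1]] := sum0_other (cyca (ea k)) (eqxx _) fk.
have [k2 [/eqP bk2 k2k fk2]] := sum0_other (cycb (eb k)) (eqxx _) fk.
have [k3 [/eqP bk3 k3k1 fk3]] := sum0_other (cycb (eb k1)) (eqxx _) fk1.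
have bneq : eb k1 != eb k by apply: contra_neq k1k => /(inj _ _ ak1).
apply: (@leq_trans #|[:: k; k1; k2; k3]|); last first.
  apply/subset_leq_card/subsetP => j.
  by rewrite !inE => /or4P[] /eqP->.
have -> : #|[:: k; k1; k2; k3]| = size [:: k; k1; k2; k3]; last by [].
apply/card_uniqP; rewrite /= !inE !negb_or (eq_sym k) k1k (eq_sym k) k2k (eq_sym k1 k3) k3k1.
have neq x y : eb x != eb y -> x != y by apply: contra_neq => ->.
by rewrite !neq // ?bk2 ?bk3 // eq_sym.
Qed.

Lemma rank_le_nonzero_rows (F : fieldType) p m (A : 'M[F]_(p, m)) :
  (\rank A <= #|[set i | row i A != 0%R]|)%N.
Proof.
have sA : (A <= \sum_(i | row i A != 0) <<row i A>>)%MS.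
  apply/row_subP => i; have [->|nz] := eqVneq (row i A) 0; first exact: sub0mx.
  by rewrite (sumsmx_sup i) // genmxE.
apply: leq_trans (mxrankS sA) _; rewrite -sum1_card.
under [X in (_ <= X)%N]eq_bigl do rewrite inE.
elim/big_ind2: _ => [|B b C c rB rC|i _]; first by rewrite mxrank0.
  exact: leq_trans (mxrank_adds_leqif _ _) (leq_add rB rC).
by rewrite genmxE rank_leq_row.
Qed.

(* Double counting: the nonzero faces span the cycle space, of dimension at
   least m - 2n + 1, have at least four edges each, and cover each edge at most
   twice. *)
Lemma bipartite_face_bound (F : fieldType) n m (ea eb : 'I_m -> 'I_n) p
    (face : 'I_p -> 'I_m -> F) :
  (0 < n)%N ->
  (forall k l, ea k = ea l -> eb k = eb l -> k = l) ->
  (forall s i, \sum_(k | ea k == i) face s k = 0) ->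
  (forall s i, \sum_(k | eb k == i) face s k = 0) ->
  (forall z : 'I_m -> F,
     (forall i, \sum_(k | ea k == i) z k = 0) ->
     (forall i, \sum_(k | eb k == i) z k = 0) ->
     exists x : 'I_p -> F, forall k, z k = \sum_s x s * face s k) ->
  (forall k, (#|[set s | face s k != 0%R]| <= 2)%N) ->
  (m.+2 <= 4 * n)%N.
Proof.
move=> n_gt0 inj cyca cycb span two.
pose D := row_mx (\matrix_(k < m, i < n) (ea k == i)%:R : 'M[F]_(m, n))
                 (\matrix_(k < m, i < n) (eb k == i)%:R).
pose A : 'M[F]_(p, m) := \matrix_(s, k) face s k.
(* [D] is the incidence matrix, black columns first. Each edge has one end of each colour, so [D]
   kills the vector that is 1 on black and -1 on white. *)
have rD : (\rank D < n + n)%N.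
  pose u : 'cV[F]_n := const_mx 1.
  have Du : D *m col_mx u (- u) = 0.
    apply/matrixP => k j; rewrite mul_row_col !mxE -[RHS](addrN (1 : F)).
    congr (_ + _).
      rewrite (bigD1 (ea k)) //= big1 ?addr0 => [|i ne]; rewrite !mxE ?eqxx ?mul1r //.
      by rewrite eq_sym (negPf ne) mul0r.
    rewrite (bigD1 (eb k)) //= big1 ?addr0 => [|i ne]; rewrite !mxE ?eqxx ?mul1r //.
    by rewrite eq_sym (negPf ne) mul0r.
  have := mulmx0_rank_max Du; suff : (0 < \rank (col_mx u (- u)))%N by lia.
  rewrite lt0n mxrank_eq0 col_mx_eq0 negb_and; apply/orP; left.
  apply/eqP => /matrixP/(_ (Ordinal n_gt0) ord0); rewrite !mxE => /eqP.
  by rewrite oner_eq0.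
have rK : (kermx D <= A)%MS.
  apply/row_subP => i; set z := row i _.
  have zD : z *m D = 0 by apply/sub_kermxP; exact: row_sub.
  have zsum (e : 'I_m -> 'I_n) (j : 'I_n) :
      (z *m (\matrix_(k < m, i < n) (e k == i)%:R : 'M[F]_(m, n))) 0 j
      = \sum_(k | e k == j) z 0 k.
    rewrite mxE [RHS]big_mkcond /=; apply: eq_bigr => k _; rewrite [X in _ * X]mxE.
    by case: eqP => _; rewrite ?mulr1 ?mulr0.
  move: zD; rewrite mul_mx_row => zD.
  have [za zb] : z *m (\matrix_(k < m, i < n) (ea k == i)%:R : 'M[F]_(m, n)) = 0 /\
                 z *m (\matrix_(k < m, i < n) (eb k == i)%:R : 'M[F]_(m, n)) = 0.
    by apply: eq_row_mx; rewrite zD row_mx0.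
  have [|| x xE] := span (z 0).
  - by move=> j; rewrite -zsum za mxE.
  - by move=> j; rewrite -zsum zb mxE.
  apply/submxP; exists (\row_s x s); apply/rowP => k.
  by rewrite xE [RHS]mxE; apply: eq_bigr => s _; rewrite !mxE.
have := mxrankS rK; rewrite mxrank_ker => dimK.
have rA := rank_le_nonzero_rows A.
set Z := [set i | row i A != 0%R] in rA.
have cZ : (4 * #|Z| <= \sum_s #|[set k | face s k != 0%R]|)%N.
  rewrite (bigID (mem Z)) /= mulnC -sum_nat_const.
  apply: leq_trans (leq_addr _ _); apply: leq_sum => s.
  rewrite inE => /rV0Pn[k]; rewrite !mxE => fk.
  by apply: (@bipartite_girth _ _ _ ea eb) => //; exists k.
have dc : (\sum_s #|[set k | face s k != 0%R]| <= 2 * m)%N.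
  under eq_bigr do rewrite -sum1_card big_mkcond.
  rewrite exchange_big /= -[m in (2 * m)%N]card_ord mulnC -sum_nat_const.
  apply: leq_sum => k _; apply: leq_trans (two k).
  rewrite -big_mkcond -sum1_card /= leq_eqVlt; apply/orP; left; apply/eqP.
  by apply: eq_bigl => s; rewrite !inE.
(* [m - (2n - 1) <= #|Z|] and [4 #|Z| <= 2m] combine to [m <= 4n - 2]. *)
lia.
Qed.

Lemma addF2 (x : 'F_2) : x + x = 0.
Proof. by apply: val_inj; case: x => [[|[|]]]. Qed.

Lemma eqF2 (x y : 'F_2) : x + y = 0 -> x = y.
Proof. by move=> xy; rewrite -[LHS]addr0 -(addF2 y) addrA xy add0r. Qed.

(** * The cycle space of a minor *)

Section Minor.
Variables (Ed T S : finType) (e0 e1 : Ed -> T) (fl fr : Ed -> S).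

Definition boundary (y : Ed -> 'F_2) (p : T) : 'F_2 :=
  \sum_d y d * ((e0 d == p)%:R + (e1 d == p)%:R).

(** The coefficient at [d] of the boundary of the 2-chain [x]; [fl] and [fr] are the faces on the
    two sides of a segment. *)
Definition face_sum (x : S -> 'F_2) (d : Ed) : 'F_2 := x (fl d) + x (fr d).

Definition adjacent (p q : T) :=
  exists d, (e0 d = p /\ e1 d = q) \/ (e0 d = q /\ e1 d = p).

Definition joined_in (B : pred T) :=
  clos_refl_trans T (fun p q => [/\ B p, B q & adjacent p q]).

(** The mod 2 sum of the segments of a path: inner points cancel and the two ends remain. *)
Lemma joined_chain (B : pred T) p q : joined_in B p q ->
  exists2 y : Ed -> 'F_2, (forall d, y d != 0 -> B (e0 d) && B (e1 d)) &
    forall t, boundary y t = (p == t)%:R + (q == t)%:R.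
Proof.
elim=> {p q} [p q [Bp Bq [d dpq]]|p|p q t _ [y sy by_] _ [z sz bz]].
- exists (fun c => (c == d)%:R) => [c|t].
    by case: (c =P d) => [-> _|]; rewrite ?eqxx //; case: dpq => -[-> ->]; rewrite Bp Bq.
  rewrite /boundary (bigD1 d) //= big1 ?eqxx ?mul1r ?addr0 => [|c /negPf->]; last by rewrite mul0r.
  by case: dpq => -[-> ->] //; rewrite addrC.
- exists (fun=> 0) => [d|t]; first by rewrite eqxx.
  by rewrite addF2 /boundary big1 // => d _; rewrite mul0r.
- exists (fun d => y d + z d) => [d|s].
    have [-> |/sy //] := eqVneq (y d) 0; rewrite add0r; exact: sz.
  rewrite /boundary; under eq_bigr do rewrite mulrDl.
  rewrite big_split /= -/(boundary y s) -/(boundary z s) by_ bz.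
  by rewrite addrA -[X in X + _]addrA addF2 addr0.
Qed.

(** The next two hypotheses say that the boundary of a boundary is zero and that cycles bound, both
    only in the interior, since the border of the grid carries junk segments. *)
Variable interior : pred T.
Hypothesis boundary_face_sum :
  forall x p, interior p -> boundary (face_sum x) p = 0.
Hypothesis fill : forall y : Ed -> 'F_2, (forall p, boundary y p = 0) ->
  (forall d, y d != 0 -> interior (e0 d) && interior (e1 d)) ->
  exists x, y =1 face_sum x.

Variables (n m : nat) (B : bool -> 'I_n -> pred T) (e : bool -> 'I_m -> 'I_n).
Variable a : 'I_m -> Ed.
Hypothesis n_gt0 : (0 < n)%N.
Hypothesis e_inj : forall k l, e false k = e false l -> e true k = e true l -> k = l.
Hypothesis B_int : forall s i p, B s i p -> interior p.
Hypothesis B_disj : forall s i s' i' p, B s i p -> B s' i' p -> s = s' /\ i = i'.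
Hypothesis B_conn : forall s i p q, B s i p -> B s i q -> joined_in (B s i) p q.
Hypothesis a_ends : forall k,
  (B false (e false k) (e0 (a k)) && B true (e true k) (e1 (a k))) ||
  (B false (e false k) (e1 (a k)) && B true (e true k) (e0 (a k))).

(** Branch sets are disjoint, so contracting them turns the segment [a k] into the edge [k] of the
    minor. *)
Lemma minor_incidence k s i :
  (B s i (e0 (a k)))%:R + (B s i (e1 (a k)))%:R = (e s k == i)%:R :> 'F_2.
Proof.
have Bend s' i' p : B s' i' p -> B s i p = ((s', i') == (s, i)).
  move=> Bp; apply/idP/eqP => [Bq|[<- <-] //].
  by have [-> ->] := B_disj Bp Bq.
case/orP: (a_ends k) => /andP[/Bend-> /Bend->]; rewrite !xpair_eqE; case: s {Bend};
  by rewrite ?eqxx /= ?addr0 ?add0r.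
Qed.

Lemma minor_edge_inj : injective a.
Proof.
move=> k l akl; have H s : e s k = e s l.
  have := minor_incidence k s (e s l).
  rewrite akl minor_incidence eqxx.
  by case: eqP => //= _ /eqP; rewrite oner_eq0.
exact: e_inj.
Qed.

Definition allowed d :=
  [exists s, exists i, B s i (e0 d) && B s i (e1 d)] || (d \in codom a).

(** Deleting a segment that is not [allowed] merges the faces on its two sides; the components of
    [dual] are the faces of the minor. *)
Definition dual := [rel s t : S | [exists d, ~~ allowed d &&
  (((fl d == s) && (fr d == t)) || ((fl d == t) && (fr d == s)))]].

Lemma dual_sym : connect_sym dual.
Proof.
apply: sym_connect_sym => s t /=; apply: eq_existsb => d.
by rewrite [X in _ && X]orbC.
Qed.

(** For a component root [s], the boundary of the merged face read on the chosen segments; zero for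
    every other [s]. *)
Definition comp_face (s : S) (k : 'I_m) : 'F_2 :=
  face_sum (fun t => (fingraph.root dual t == s)%:R) (a k).

(** Add up the vanishing boundaries of the merged face over one branch set. Deleted segments have
    the same component on both sides, segments inside a branch set count twice or not at all, and
    what remains is the sum over chosen segments. *)
Lemma comp_face_cycle s b i : \sum_(k | e b k == i) comp_face s k = 0.
Proof.
pose x t : 'F_2 := (fingraph.root dual t == s)%:R.
have x0 d : ~~ allowed d -> face_sum x d = 0.
  move=> nd; rewrite /face_sum /x.
  suff -> : fingraph.root dual (fl d) = fingraph.root dual (fr d) by rewrite addF2.
  apply/eqP; rewrite (root_connect dual_sym); apply: connect1 => /=.
  by apply/existsP; exists d; rewrite nd !eqxx.
have : \sum_(p | B b i p) boundary (face_sum x) p = 0.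
  by apply: big1 => p /B_int; apply: boundary_face_sum.
rewrite exchange_big /=.
have -> : \sum_d \sum_(p | B b i p) face_sum x d * ((e0 d == p)%:R + (e1 d == p)%:R)
    = \sum_d face_sum x d * ((B b i (e0 d))%:R + (B b i (e1 d))%:R).
  apply: eq_bigr => d _; rewrite -mulr_sumr; congr (_ * _).
  rewrite big_split /=; congr (_ + _).
  - have [Bd|Bd] := boolP (B b i _).
      by rewrite (bigD1 (e0 d)) //= eqxx big1 ?addr0 // => p /andP[_]; rewrite eq_sym => /negPf->.
    by rewrite big1 // => p Bp; case: eqP => // dp; rewrite dp Bp in Bd.
  - have [Bd|Bd] := boolP (B b i _).
      by rewrite (bigD1 (e1 d)) //= eqxx big1 ?addr0 // => p /andP[_]; rewrite eq_sym => /negPf->.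
    by rewrite big1 // => p Bp; case: eqP => // dp; rewrite dp Bp in Bd.
rewrite (bigID (mem (codom a))) /= [X in _ + X]big1 => [|d nad]; last first.
  have [|/x0->] := boolP (allowed d); last by rewrite mul0r.
  rewrite /allowed (negPf nad) orbF => /existsP[s' /existsP[i' /andP[B0 B1]]].
  suff -> : B b i (e0 d) = B b i (e1 d) by rewrite addF2 mulr0.
  by apply/idP/idP => Bd; [case: (B_disj B0 Bd) => <- <-|case: (B_disj B1 Bd) => <- <-].
rewrite addr0 => H; rewrite -[RHS]H [LHS]big_mkcond /=.
have -> : \sum_(d in codom a) face_sum x d * ((B b i (e0 d))%:R + (B b i (e1 d))%:R)
  = \sum_(d in a @: setT) face_sum x d * ((B b i (e0 d))%:R + (B b i (e1 d))%:R).
  apply: eq_bigl => d; apply/codomP/imsetP => [[k ->]|[k _ ->]]; first by exists k.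
  by exists k.
rewrite big_imset; last by move=> k l _ _; apply: minor_edge_inj.
under [RHS]eq_bigl do rewrite inE.
by apply: eq_bigr => k _; rewrite minor_incidence; case: eqP; rewrite ?mulr1 ?mulr0.
Qed.

(** Fix a base point in each branch set and lift an edge to a path through [a k] from base to base.
    In the combination weighted by [z], the boundary at each base is a vertex sum of [z], hence
    zero. *)
Lemma minor_lift (z : 'I_m -> 'F_2) :
  (forall b i, \sum_(k | e b k == i) z k = 0) ->
  exists y : Ed -> 'F_2, [/\ forall p, boundary y p = 0,
    forall d, y d != 0 -> allowed d & forall k, y (a k) = z k].
Proof.
move=> cyc; have [m0|m_gt0] := posnP m.
  exists (fun=> 0); split => [p|d|k]; last by have := ltn_ord k; rewrite [X in (_ < X)%N]m0.
    by rewrite /boundary big1 // => d _; rewrite mul0r.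
  by rewrite eqxx.
(* The default, for empty branch sets, needs some edge; hence the separate case [m = 0]. *)
pose base s i := odflt (e0 (a (Ordinal m_gt0))) [pick p | B s i p].
have baseP s i p : B s i p -> B s i (base s i).
  by move=> Bp; rewrite /base; case: pickP => //= /(_ p); rewrite Bp.
have : forall k, exists c : Ed -> 'F_2, [/\ forall p, boundary c p =
      (base false (e false k) == p)%:R + (base true (e true k) == p)%:R,
    forall d, c d != 0 -> allowed d & forall l, c (a l) = (k == l)%:R].
  move=> k.
  have [p [q [Bp Bq pq]]] : exists p q,
      [/\ B false (e false k) p, B true (e true k) q &
         forall t, (e0 (a k) == t)%:R + (e1 (a k) == t)%:R = (p == t)%:R + (q == t)%:R :> 'F_2].
    case/orP: (a_ends k) => /andP[? ?];
      [exists (e0 (a k)), (e1 (a k))|exists (e1 (a k)), (e0 (a k))].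
      by [].
    by split=> // t; rewrite addrC.
  have [y sy by_] := joined_chain (B_conn (baseP _ _ _ Bp) Bp).
  have [y' sy' by'] := joined_chain (B_conn (baseP _ _ _ Bq) Bq).
  (* A chosen segment joins a black to a white set, so it lies inside no branch set. *)
  have chain0 s (w : Ed -> 'F_2) l :
      (forall d, w d != 0 -> B s (e s k) (e0 d) && B s (e s k) (e1 d)) ->
      w (a l) = 0.
    move=> sw; apply/eqP/negPn/negP => /sw /andP[B0 B1].
    case/orP: (a_ends l) => /andP[C0 C1].
      by have [E0 _] := B_disj B0 C0; have [E1 _] := B_disj B1 C1; rewrite E0 in E1.
    by have [E0 _] := B_disj B1 C0; have [E1 _] := B_disj B0 C1; rewrite E0 in E1.
  exists (fun d => y d + y' d + (d == a k)%:R); split=> [t|d|l].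
  - rewrite /boundary; under eq_bigr do rewrite !mulrDl.
    rewrite !big_split /= -/(boundary y t) -/(boundary y' t) by_ by'.
    rewrite (bigD1 (a k)) //= eqxx mul1r pq big1 => [|d /negPf->]; last by rewrite mul0r.
    rewrite addr0 (addrACA _ (p == t)%:R) -addrA -[RHS]addr0; congr (_ + _); exact: addF2.
  - rewrite /allowed; case: (d =P a k) => [->|_]; first by rewrite codom_f orbT.
    rewrite addr0 => nz; apply/orP; left.
    have [y0|/sy Hy] := eqVneq (y d) 0.
      rewrite y0 add0r in nz.
      by apply/existsP; exists true; apply/existsP; exists (e true k); apply: sy'.
    by apply/existsP; exists false; apply/existsP; exists (e false k).
  - rewrite (chain0 false) // (chain0 true) // !add0r (inj_eq minor_edge_inj).
    by rewrite eq_sym.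
move/fin_all_exists => [c Hc].
exists (fun d => \sum_k z k * c k d); split=> [p|d|l].
- rewrite /boundary; under eq_bigr do rewrite mulr_suml.
  rewrite exchange_big /=.
  have -> : \sum_k \sum_d z k * c k d * ((e0 d == p)%:R + (e1 d == p)%:R) =
      \sum_k (z k * (base false (e false k) == p)%:R + z k * (base true (e true k) == p)%:R).
    apply: eq_bigr => k _; rewrite -mulrDr; have [<- _ _] := Hc k.
    by rewrite /boundary mulr_sumr; apply: eq_bigr => d _; rewrite mulrA.
  have zero s : \sum_k z k * (base s (e s k) == p)%:R = 0.
    rewrite (partition_big (e s) xpredT) //= big1 // => i _.
    rewrite -[RHS](mul0r (base s i == p)%:R) -[X in X * _](cyc s i) mulr_suml.
    by apply: eq_bigr => k /eqP->.
  by rewrite big_split /= !zero addr0.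
- apply: contraNT => nd; rewrite big1 // => k _.
  have [_ sc _] := Hc k; have [->|/sc] := eqVneq (c k d) 0; first by rewrite mulr0.
  by rewrite (negPf nd).
- rewrite (bigD1 l) //= big1 ?addr0 => [|k /negPf kl].
    by have [_ _ ->] := Hc l; rewrite eqxx mulr1.
  by have [_ _ ->] := Hc k; rewrite kl mulr0.
Qed.

(** The lifted cycle bounds a 2-chain [x] by [fill]. It vanishes on deleted segments, so [x] is
    constant on components of [dual], and its values at the roots are the coefficients. *)
Lemma comp_face_span (z : 'I_m -> 'F_2) :
  (forall b i, \sum_(k | e b k == i) z k = 0) ->
  exists x : S -> 'F_2, forall k, z k = \sum_s x s * comp_face s k.
Proof.
move=> /minor_lift[y [bdy supp yz]].
have [|x yx] := fill bdy.
  move=> d /supp /orP[/existsP[s /existsP[i /andP[/B_int-> /B_int->]]] //|/codomP[k ->]].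
  by case/orP: (a_ends k) => /andP[/B_int-> /B_int->].
have xconn s t : connect dual s t -> x s = x t.
  case/connectP=> p + ->; elim: p s => //= u p IH s /andP[su pu]; rewrite -(IH u pu).
  have /existsP[d /andP[nd H]] := su.
  have : face_sum x d = 0 by rewrite -yx; apply/eqP/negPn/negP => /supp; apply/negP.
  by case/orP: H => /andP[/eqP <- /eqP <-] /eqF2.
have xroot s : x (fingraph.root dual s) = x s by rewrite -(xconn _ _ (connect_root dual s)).
exists x => k; rewrite -yz yx /face_sum /comp_face.
rewrite [RHS](eq_bigr (fun s => x s * (fingraph.root dual (fl (a k)) == s)%:R
   + x s * (fingraph.root dual (fr (a k)) == s)%:R)) => [|s _]; last by rewrite -mulrDr.
have pick u : \sum_s x s * (fingraph.root dual u == s)%:R = x u.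
  rewrite (bigD1 (fingraph.root dual u)) //= eqxx mulr1 xroot big1 ?addr0 // => s.
  by rewrite eq_sym => /negPf->; rewrite mulr0.
by rewrite big_split /= !pick.
Qed.

Lemma minor_bound : (m.+2 <= 4 * n)%N.
Proof.
apply: (@bipartite_face_bound 'F_2 n m (e false) (e true) #|S|
         (fun s => comp_face (enum_val s))) => //.
- by move=> s i; apply: comp_face_cycle.
- by move=> s i; apply: comp_face_cycle.
- move=> z ca cb; have [|x xE] := @comp_face_span z; first by case.
  exists (fun s => x (enum_val s)) => k; rewrite xE.
  by rewrite -(big_enum_val (fun s => x s * comp_face s k)); apply: eq_bigl.
- move=> k; rewrite -(card_imset _ enum_val_inj).
  (* Only the components of the two faces beside [a k] can contain it in their boundary. *)
  apply: leq_trans (_ : (#|[set fingraph.root dual (fl (a k)); fingraph.root dual (fr (a k))]|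
      <= 2)%N); last first.
    by rewrite cards2; case: eqP.
  apply/subset_leq_card/subsetP => s /imsetP[t]; rewrite !inE => nz ->.
  apply: contraNT nz; rewrite negb_or /comp_face /face_sum ![enum_val t == _]eq_sym.
  by case/andP=> /negPf-> /negPf->; rewrite addr0.
Qed.
End Minor.

(** * The square grid: cycles bound *)

Section Grid.
Variable N : nat.
Let pt : finType := ('I_N.+1 * 'I_N.+1)%type.
Let seg : finType := (bool * pt)%type.

(* (false, p) is the horizontal unit segment to the right of p, (true, p) the
   vertical one above p; as a face, p is the unit square with lower left corner
   p. Beyond the border, [inord] produces junk, which only affects the border. *)
Definition seg_start (d : seg) : pt := d.2.
Definition seg_end (d : seg) : pt :=
  if d.1 then (d.2.1, inord d.2.2.+1) else (inord d.2.1.+1, d.2.2).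
Definition seg_right (d : seg) : pt :=
  if d.1 then (inord d.2.1.-1, d.2.2) else (d.2.1, inord d.2.2.-1).

Definition grid_interior (p : pt) :=
  [&& (0 < p.1)%N, (p.1 < N)%N, (0 < p.2)%N & (p.2 < N)%N].

Notation bd := (boundary seg_start seg_end).
Notation fs := (face_sum seg_start seg_right).

Lemma inord_succ_eq (i j : 'I_N.+1) : (0 < j)%N -> (inord i.+1 == j) = (i == inord j.-1).
Proof.
move=> j0; rewrite -!val_eqE /= [in RHS]inordK; last by have := ltn_ord j; lia.
have [iN|iN] := ltnP i.+1 N.+1; first by rewrite inordK //; lia.
(* On overflow [inord] returns 0, which is not [j], while [i = N] exceeds [j.-1]: both sides are
   false. *)
rewrite /inord /insubd insubF /=; last lia.
by have := ltn_ord j; have := ltn_ord i; lia.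
Qed.

Lemma grid_boundary y p : grid_interior p ->
  bd y p = y (false, p) + y (false, (inord p.1.-1, p.2))
         + (y (true, p) + y (true, (p.1, inord p.2.-1))).
Proof.
case: p => i j /and4P[/= i0 iN j0 jN].
have pickp (f : pt -> 'F_2) q (P : pred pt) : P =1 pred1 q -> \sum_p f p * (P p)%:R = f q.
  move=> Pq; rewrite (bigD1 q) //= Pq /= eqxx mulr1 big1 ?addr0 // => r /negPf rq.
  by rewrite Pq /= rq mulr0.
have -> : bd y (i, j) = \sum_b \sum_q y (b, q) *
    ((seg_start (b, q) == (i, j))%:R + (seg_end (b, q) == (i, j))%:R).
  by rewrite pair_bigA; apply: eq_bigr => -[].
rewrite big_bool /= addrC.
congr (_ + _); under eq_bigr do rewrite mulrDr.
  rewrite big_split /= (pickp _ (i, j)) // (pickp _ (inord i.-1, j)) // => -[u v].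
  by rewrite /seg_end /= !xpair_eqE inord_succ_eq.
rewrite big_split /= (pickp _ (i, j)) // (pickp _ (i, inord j.-1)) // => -[u v].
by rewrite /seg_end /= !xpair_eqE inord_succ_eq.
Qed.

(** Each of the four squares around [p] borders two of the four segments at [p]. *)
Lemma grid_boundary_face_sum x p : grid_interior p -> bd (fs x) p = 0.
Proof.
move=> Ip; rewrite grid_boundary // /face_sum /seg_right /seg_start /=.
by rewrite [X in X + _]addrACA addF2.
Qed.

(** [x p] is the parity of horizontal segments of [y] crossed when climbing to the square [p] from
    below. Horizontal segments then come out right by construction, and vertical ones by induction
    on the height, using the boundary condition at each point. *)
Lemma grid_fill y : (forall p, bd y p = 0) ->
  (forall d, y d != 0 -> grid_interior (seg_start d) && grid_interior (seg_end d)) ->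
  exists x, y =1 fs x.
Proof.
move=> bdy supp.
have y0 d : ~~ grid_interior (seg_start d) || ~~ grid_interior (seg_end d) -> y d = 0.
  by rewrite -negb_and => nd; apply/eqP/negPn/negP => /supp; apply/negP.
pose x (p : pt) := \sum_(t < N.+1 | (t <= p.2)%N) y (false, (p.1, t)).
have step (i : 'I_N.+1) (j k : 'I_N.+1) : j = k.+1 :> nat ->
    x (i, j) = x (i, k) + y (false, (i, j)).
  move=> jk; rewrite /x (bigD1 j) //= addrC; congr (_ + _).
  by apply: eq_bigl => t; rewrite -val_eqE /=; lia.
have x0 (i j : 'I_N.+1) : j = 0%N :> nat -> x (i, j) = 0.
  move=> j0; rewrite /x big1 // => t /= tj; apply: y0.
  by rewrite /grid_interior /seg_start /=; lia.
have vert k (i j : 'I_N.+1) : j = k :> nat -> (0 < i)%N ->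
    y (true, (i, j)) = x (i, j) + x (inord i.-1, j).
  elim: k i j => [|k IH] i j jk i0.
    rewrite !x0 // addr0; apply: y0; rewrite /grid_interior /seg_start /=; lia.
  have kN : (k < N.+1)%N by have := ltn_ord j; lia.
  rewrite !(step _ j (Ordinal kN)) // addrACA -IH //.
  have [Ip|Ip] := boolP (grid_interior (i, j)).
    have := bdy (i, j); rewrite grid_boundary //=.
    have -> : inord j.-1 = Ordinal kN by apply: val_inj; rewrite /= inordK; lia.
    by move/eqF2 => ->; rewrite addrCA addF2 addr0.
  have edge_zero d : seg_start d = (i, j) \/ seg_end d = (i, j) -> y d = 0.
    by move=> H; apply: y0; case: H => ->; rewrite Ip ?orbT.
  rewrite (edge_zero (true, (i, j))); last by left.
  rewrite (edge_zero (false, (i, j))); last by left.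
  rewrite (edge_zero (true, (i, Ordinal kN))); last first.
    by right; congr (_, _); apply: val_inj; rewrite /= inordK -?jk.
  rewrite (edge_zero (false, (inord i.-1, j))) ?addr0 //.
  right; congr (_, _); apply: val_inj; rewrite /= !inordK; have := ltn_ord i; lia.
exists x => -[[] [i j]]; rewrite /face_sum /seg_right /seg_start /=.
  (* On the left border [inord] makes the two faces equal, and [y] vanishes there. *)
  have [i0|i0] := posnP i; last exact: vert.
  have -> : inord i.-1 = i by apply: val_inj; rewrite /= inordK; lia.
  by rewrite addF2 y0 // /grid_interior /seg_start /= i0.
have [j0|j0] := posnP j.
  have -> : inord j.-1 = j by apply: val_inj; rewrite /= inordK; lia.
  by rewrite addF2 y0 // /grid_interior /seg_start /= j0 /= !andbF.
have jE : j = (inord j.-1 : 'I_N.+1).+1 :> nat.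
  by rewrite inordK; have := ltn_ord j; lia.
by rewrite (step i j _ jE) addrAC addF2 add0r.
Qed.
End Grid.

(** * Transfer to finite types and the final count *)

Definition grid_pt N (p : nat * nat) : 'I_N.+1 * 'I_N.+1 := (inord p.1, inord p.2).

Lemma grid_adj_seg N (p q : nat * nat) :
  (p.1 < N /\ p.2 < N)%N -> (q.1 < N /\ q.2 < N)%N -> grid_adj p q ->
  adjacent (@seg_start N) (@seg_end N) (grid_pt N p) (grid_pt N q).
Proof.
case: p q => [p1 p2] [q1 q2] /= [p1N p2N] [q1N q2N] /= [[/= <-]|[/= <-]] [<-|<-].
- by exists (true, grid_pt N (p1, p2)); left; rewrite /seg_end /= inordK //; lia.
- by exists (true, grid_pt N (p1, q2)); right; rewrite /seg_end /= inordK //; lia.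
- by exists (false, grid_pt N (p1, p2)); left; rewrite /seg_end /= inordK //; lia.
- by exists (false, grid_pt N (q1, p2)); right; rewrite /seg_end /= inordK //; lia.
Qed.

Lemma grid_minor_edges n (E : nat -> nat -> Prop) : (0 < n)%N -> grid_minor n E ->
  (#|[set ab : 'I_n * 'I_n | `[< E ab.1 ab.2 >]]|.+2 <= 4 * n)%N.
Proof.
move=> n_gt0 [N [B [Bint [Bdisj [Bconn Bedge]]]]]; set Eset := [set _ | _].
pose C s (i : 'I_n) (p : 'I_N.+1 * 'I_N.+1) := `[< B s i (val p.1, val p.2) >].
pose e s (k : 'I_#|Eset|) := if s then (enum_val k).2 else (enum_val k).1.
have Bbd s i p : B s i p -> (p.1 < N /\ p.2 < N)%N.
  by move=> /Bint[[_ /ltP ?] [_ /ltP ?]].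
have toC s (i : 'I_n) p : B s i p -> C s i (grid_pt N p).
  case: p => p1 p2 Bp; have [/= ? ?] := Bbd _ _ _ Bp.
  by apply/asboolP; rewrite /= !inordK ?ltnS // ltnW.
have : forall k, exists d,
    (C false (e false k) (seg_start d) && C true (e true k) (seg_end d)) ||
    (C false (e false k) (seg_end d) && C true (e true k) (seg_start d)).
  move=> k; have := enum_valP k; rewrite inE => /asboolP Ek.
  have [p [q [Bp [Bq pq]]]] := Bedge _ _ (elimT ltP (ltn_ord _)) (elimT ltP (ltn_ord _)) Ek.
  have [d dpq] := grid_adj_seg (Bbd _ _ _ Bp) (Bbd _ _ _ Bq) pq.
  exists d; have Cp := toC false (enum_val k).1 _ Bp; have Cq := toC true (enum_val k).2 _ Bq.
  by case: dpq => -[-> ->]; rewrite Cp Cq ?orbT.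
move/fin_all_exists => [a a_ends].
apply: (@minor_bound _ _ _ (@seg_start N) (@seg_end N) (@seg_start N) (@seg_right N)
  (@grid_interior N) _ _ n #|Eset| C e a) => //.
- exact: grid_boundary_face_sum.
- exact: grid_fill.
- move=> k l kl kl'; apply: enum_val_inj; apply/eqP.
  by rewrite -pair_eqE /pair_eq; apply/andP; split; apply/eqP.
- by move=> s i p /asboolP/Bint[[/ltP ? /ltP ?] [/ltP ? /ltP ?]]; apply/and4P; split.
- move=> s i s' i' p /asboolP Bp /asboolP Bp'.
  by have [-> /val_inj] := Bdisj _ _ _ _ _ Bp Bp'.
- move=> s i p q /asboolP Bp /asboolP Bq; have := Bconn _ _ _ _ Bp Bq.
  have ptK (r : 'I_N.+1 * 'I_N.+1) : grid_pt N (val r.1, val r.2) = r.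
    by case: r => u v; rewrite /grid_pt /= !inord_val.
  rewrite -[X in joined_in _ _ _ X _]ptK -[X in joined_in _ _ _ _ X]ptK.
  elim=> {p q Bp Bq} [p q [Bp [Bq pq]]|p|p q r _ IH _ IH'].
  + apply: rt_step; split; [exact: toC|exact: toC|].
    exact: grid_adj_seg (Bbd _ _ _ Bp) (Bbd _ _ _ Bq) pq.
  + exact: rt_refl.
  + exact: rt_trans IH IH'.
Qed.

Lemma grid_minor_cover n k (E : nat -> nat -> nat -> Prop) : (2 <= n)%coq_nat ->
  (forall i, (i < k)%coq_nat -> grid_minor n (E i)) ->
  (forall a b, (a < n)%coq_nat -> (b < n)%coq_nat -> a <> b ->
     exists i, (i < k)%coq_nat /\ E i a b) ->
  (n <= 4 * k)%coq_nat.
Proof.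
move=> /leP n2 minor cover.
pose Es i := [set ab : 'I_n * 'I_n | `[< E i ab.1 ab.2 >]].
have sub : [set ab : 'I_n * 'I_n | ab.1 != ab.2] \subset \bigcup_(i < k) Es i.
  apply/subsetP => -[a b]; rewrite inE /= => ab.
  have [|i [/ltP ik Ei]] := cover _ _ (elimT ltP (ltn_ord a)) (elimT ltP (ltn_ord b)).
    by move/val_inj => abE; rewrite abE eqxx in ab.
  by apply/bigcupP; exists (Ordinal ik) => //; rewrite inE; apply/asboolP.
have cardN : (#|[set ab : 'I_n * 'I_n | ab.1 != ab.2]| + n = n * n)%N.
  have <- : #|{: 'I_n * 'I_n}| = (n * n)%N by rewrite card_prod card_ord.
  rewrite -(cardC [pred ab : 'I_n * 'I_n | ab.1 != ab.2]).
  congr (_ + _)%N; first by rewrite cardsE.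
  have diag_inj : injective (fun i : 'I_n => (i, i)) by move=> i j [].
  rewrite -[LHS](card_ord n) -(card_imset _ diag_inj).
  apply: eq_card => -[a b]; rewrite !inE /= negbK; apply/imsetP/eqP => [[i _ [-> ->]] //|<-].
  by exists a.
have : (\sum_(i < k) #|Es i| <= \sum_(i < k) (4 * n - 2))%N.
  apply: leq_sum => i _.
  have := @grid_minor_edges n (E i) (ltnW n2) (minor i (elimT ltP (ltn_ord i))).
  rewrite -/(Es i); lia.
have union : (#|\bigcup_(i < k) Es i| <= \sum_(i < k) #|Es i|)%N.
  elim/big_ind2: _ => [|A p B q Ap Bq|//]; first by rewrite cards0.
  exact: leq_trans (leq_card_setU _ _) (leq_add Ap Bq).
have := leq_trans (subset_leq_card sub) union.
rewrite sum_nat_const card_ord; set x := #|_|; set y := (\sum_(i < k) _)%N => xy yk.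
(* The count reads [n(n - 1) <= k(4n - 2)]. If [n > 4k], the left side is at least [4kn], which is
   too large for positive [k]; for [k = 0] it contradicts [2 <= n]. *)
apply/leP; rewrite leqNgt; apply/negP => kn; nia.
Qed.

End Minor.

(* ceil(n/4) = (n+3)/4 in nat *)
Theorem theorem3p3 (n : nat) (hn : (2 <= n)%nat) :
  is_thickness (kron (K n) (K 2)) ((n + 3) / 4).
Proof.
split; [apply kron_union_of_planar|].
intros k [SV [SE [SVG [SEV [_ [cover planarS]]]]]].
assert (n <= 4 * k)%nat as nk.
{ apply Minor.grid_minor_cover with
    (E := fun i a b => (a < n)%nat /\ (b < n)%nat /\ SE i (a, 0%nat) (b, 1%nat)); auto.
  - intros i ik; apply (planar_grid_minor _ (SV i) (SE i) n
      (fun a => (a, 0%nat)) (fun b => (b, 1%nat))); try congruence; auto.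
    intros x y H; destruct (SEV i x y ik H) as [? [? _]]; auto.
  - intros a b an bn ab.
    destruct (cover (a, 0%nat) (b, 1%nat)) as [i [ik H]];
      [simpl; lia|simpl; lia|simpl; lia|exists i; auto]. }
apply Nat.lt_succ_r, Nat.Div0.div_lt_upper_bound; lia.
Qed.
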